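(* Let $M\subseteq\mathbb{R}^n$ be open, let $V_i=(Y_i,C_i,\tau_i,H_i)$, $i=1,\dots,k$, be general infinitesimal stochastic transformations on $M$ such that $K=\mathrm{span}_{\mathbb{R}}\{V_1,\dots,V_k\}$ is a Lie algebra, and let $x_0\in M$ be such that $Y_1(x_0),\dots,Y_k(x_0)$ are linearly independent. Then there exist an open neighborhood $U$ of $x_0$ and a stochastic transformation of the form $T=(\mathrm{id}_U,B,\eta,h)$ (with $B:U\to SO(m)$, $\eta:U\to\mathbb{R}_+$, $h:U\to\mathbb{R}^m$ smooth) such that $T_*(V_1),\dots,T_*(V_k)$ are strong infinitesimal stochastic transformations. Furthermore, the smooth functions $B,\eta,h$ are solutions on $U$ to the equations $$Y_i(B)=-B\cdot C_i,\qquad Y_i(\eta)=-\tau_i\eta,\qquad Y_i(h)=\Big(-\frac{\tau_i}{2}+C_i\Big)h-H_i,\qquad i=1,\dots,k.$$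
   Context: An infinitesimal (general) stochastic transformation on $M$ is a quadruple $V=(Y,C,\tau,H)$ where $Y$ is a smooth vector field on $M$ and $C:M\to\mathfrak{so}(m)$, $\tau:M\to\mathbb{R}$, $H:M\to\mathbb{R}^m$ are smooth. It is called strong if $C=0$, $\tau=0$, $H=0$, i.e. $V=(Y,0,0,0)$. $\mathbb{R}_+$ denotes the strictly positive reals. $Y$ acts componentwise on vector- and matrix-valued functions as a derivation. ''Lie algebra'' refers to closure under the bracket $$[V_1,V_2]=\Big([Y_1,Y_2],\ Y_1(C_2)-Y_2(C_1)-\{C_1,C_2\},\ Y_1(\tau_2)-Y_2(\tau_1),\ Y_1(H_2)-Y_2(H_1)-\big(-\tfrac{\tau_1}{2}+C_1\big)H_2+\big(-\tfrac{\tau_2}{2}+C_2\big)H_1\Big),$$ with $\{C_1,C_2\}=C_1C_2-C_2C_1$. A (finite) stochastic transformation is a quadruple $T=(\Phi,B,\eta,h)$ with $\Phi$ a diffeomorphism between open subsets of $\mathbb{R}^n$ and $B,\eta,h$ smooth functions on the domain of $\Phi$ with values in $SO(m)$, $\mathbb{R}_+$, $\mathbb{R}^m$. The pushforward of $V=(Y,C,\tau,H)$ (restricted to the domain of $\Phi$) through $T$ is $$T_*(V)=\Big(\Phi_*(Y),\ \big(BCB^{-1}+Y(B)B^{-1}\big)\circ\Phi^{-1},\ \big(\tau+\tfrac{Y(\eta)}{\eta}\big)\circ\Phi^{-1},\ \big(-\tfrac{1}{\sqrt\eta}B(-\tfrac{\tau}{2}+C)h+\tfrac{1}{\sqrt\eta}BH+\tfrac{1}{\sqrt\eta}BY(h)\big)\circ\Phi^{-1}\Big),$$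 with $\Phi_*(Y)=(\nabla\Phi\cdot Y)\circ\Phi^{-1}$, $\nabla\Phi$ the Jacobian matrix. *)

(* Defs.v *)
From HB Require Import structures.
From mathcomp Require Import all_boot all_order all_algebra.
From mathcomp Require Import all_classical all_reals all_analysis.

Set Implicit Arguments.
Unset Strict Implicit.
Unset Printing Implicit Defensive.

Import Order.TTheory GRing.Theory Num.Theory.
Import numFieldNormedType.Exports.

Local Open Scope classical_set_scope.
Local Open Scope ring_scope.

(* Points and tangent vectors of R^n are row vectors, so that the library
   Jacobian ['J f x], which acts on rows from the right
   ([deriveEjacobian : 'D_v f x = v *m 'J f x]), is the Jacobian matrix of f;
   elements of R^m are column vectors, on which matrices act from the left.
   A function on an open set U is represented by a total function, and only its
   values on U matter: the hypotheses and conclusions below are all restricted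
   to open sets, on which derivatives depend on these values only. *)

(* f is C^k on the open set U *)
Fixpoint Ck_on (R : realType) (V W : normedModType R) (k : nat) (U : set V)
    (f : V -> W) : Prop :=
  match k with
  | 0 => {in U, continuous f}
  | k'.+1 => (forall x, U x -> differentiable f x) /\
             (forall v : V, Ck_on k' U ('D_v f))
  end.

Definition smooth_on (R : realType) (V W : normedModType R) (U : set V)
  (f : V -> W) : Prop := forall k : nat, Ck_on k U f.

(* Y(f); for matrix-valued f the derivative is taken entrywise. *)
Definition vf_act (R : realType) (n : nat) (W : normedModType R)
    (Y : 'rV[R]_n -> 'rV[R]_n) (f : 'rV[R]_n -> W) : 'rV[R]_n -> W :=
  fun x => 'D_(Y x) f x.

Definition vf_bracket (R : realType) (n : nat) (Y1 Y2 : 'rV[R]_n -> 'rV[R]_n) :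
    'rV[R]_n -> 'rV[R]_n :=
  fun x => vf_act Y1 Y2 x - vf_act Y2 Y1 x.

Definition special_orthogonal (R : realType) (m : nat) : set 'M[R]_m :=
  [set A | A *m A^T = 1%:M /\ \det A = 1].

Definition skew (R : realType) (m : nat) : set 'M[R]_m :=
  [set A | A^T = - A].

Definition commutator (R : realType) (m : nat) (A B : 'M[R]_m) : 'M[R]_m :=
  A *m B - B *m A.

Record inf_stoch (R : realType) (n m : nat) := InfStoch {
  istY : 'rV[R]_n -> 'rV[R]_n;
  istC : 'rV[R]_n -> 'M[R]_m;
  isttau : 'rV[R]_n -> R;
  istH : 'rV[R]_n -> 'cV[R]_m
}.

Definition is_inf_stoch (R : realType) (n m : nat) (M : set 'rV[R]_n)
    (V : inf_stoch R n m) : Prop :=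
  [/\ smooth_on M (istY V),
      smooth_on M (istC V) /\ (forall x, M x -> skew (istC V x)),
      smooth_on M (isttau V) &
      smooth_on M (istH V)].

Definition is_strong_inf_stoch (R : realType) (n m : nat) (M : set 'rV[R]_n)
    (V : inf_stoch R n m) : Prop :=
  is_inf_stoch M V /\
  (forall x, M x -> [/\ istC V x = 0, isttau V x = 0 & istH V x = 0]).

Definition ist_eq_on (R : realType) (n m : nat) (M : set 'rV[R]_n)
    (V W : inf_stoch R n m) : Prop :=
  forall x, M x ->
    [/\ istY V x = istY W x, istC V x = istC W x,
        isttau V x = isttau W x & istH V x = istH W x].

Definition ist_lincomb (R : realType) (n m k : nat) (c : 'I_k -> R)
    (V : 'I_k -> inf_stoch R n m) : inf_stoch R n m :=
  InfStoch (fun x => \sum_(i < k) c i *: istY (V i) x)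
           (fun x => \sum_(i < k) c i *: istC (V i) x)
           (fun x => \sum_(i < k) c i * isttau (V i) x)
           (fun x => \sum_(i < k) c i *: istH (V i) x).

Definition ist_span (R : realType) (n m k : nat) (M : set 'rV[R]_n)
    (V : 'I_k -> inf_stoch R n m) : set (inf_stoch R n m) :=
  [set W | exists c : 'I_k -> R, ist_eq_on M W (ist_lincomb c V)].

Definition ist_bracket (R : realType) (n m : nat) (V1 V2 : inf_stoch R n m) :
    inf_stoch R n m :=
  InfStoch
    (vf_bracket (istY V1) (istY V2))
    (fun x => vf_act (istY V1) (istC V2) x - vf_act (istY V2) (istC V1) x
              - commutator (istC V1 x) (istC V2 x))
    (fun x => vf_act (istY V1) (isttau V2) x - vf_act (istY V2) (isttau V1) x)
    (fun x => vf_act (istY V1) (istH V2) x - vf_act (istY V2) (istH V1) x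
              - ((- (isttau V1 x / 2))%:M + istC V1 x) *m istH V2 x
              + ((- (isttau V2 x / 2))%:M + istC V2 x) *m istH V1 x).

Definition bracket_closed (R : realType) (n m : nat)
    (K : set (inf_stoch R n m)) : Prop :=
  forall V1 V2, K V1 -> K V2 -> K (ist_bracket V1 V2).

(* The inverse of Phi is part of the data. *)
Record stoch_transf (R : realType) (n m : nat) := StochTransf {
  stdom : set 'rV[R]_n;
  stcod : set 'rV[R]_n;
  stPhi : 'rV[R]_n -> 'rV[R]_n;
  stPhiV : 'rV[R]_n -> 'rV[R]_n;
  stB : 'rV[R]_n -> 'M[R]_m;
  steta : 'rV[R]_n -> R;
  sth : 'rV[R]_n -> 'cV[R]_m
}.

Definition diffeo_on (R : realType) (n : nat) (U U' : set 'rV[R]_n)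
    (Phi PhiV : 'rV[R]_n -> 'rV[R]_n) : Prop :=
  [/\ open U, open U',
      set_fun U U' Phi /\ smooth_on U Phi,
      set_fun U' U PhiV /\ smooth_on U' PhiV &
      {in U, cancel Phi PhiV} /\ {in U', cancel PhiV Phi}].

Definition is_stoch_transf (R : realType) (n m : nat)
    (T : stoch_transf R n m) : Prop :=
  let U := stdom T in
  [/\ diffeo_on U (stcod T) (stPhi T) (stPhiV T),
      smooth_on U (stB T) /\ (forall x, U x -> special_orthogonal (stB T x)),
      smooth_on U (steta T) /\ (forall x, U x -> 0 < steta T x) &
      smooth_on U (sth T)].

Definition vf_pushforward (R : realType) (n : nat)
    (Phi PhiV : 'rV[R]_n -> 'rV[R]_n) (Y : 'rV[R]_n -> 'rV[R]_n) :
    'rV[R]_n -> 'rV[R]_n :=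
  (fun x => Y x *m 'J Phi x) \o PhiV.

Definition st_pushforward (R : realType) (n m : nat) (T : stoch_transf R n m)
    (V : inf_stoch R n m) : inf_stoch R n m :=
  let B := stB T in
  let eta := steta T in
  let h := sth T in
  let: InfStoch Y C tau H := V in
  InfStoch
    (vf_pushforward (stPhi T) (stPhiV T) Y)
    ((fun x => B x *m C x *m invmx (B x) + vf_act Y B x *m invmx (B x))
       \o stPhiV T)
    ((fun x => tau x + vf_act Y eta x / eta x) \o stPhiV T)
    ((fun x =>
        - ((Num.sqrt (eta x))^-1 *:
             (B x *m ((- (tau x / 2))%:M + C x) *m h x))
        + (Num.sqrt (eta x))^-1 *: (B x *m H x)
        + (Num.sqrt (eta x))^-1 *: (B x *m vf_act Y h x))
       \o stPhiV T).

Definition id_transf (R : realType) (n m : nat) (U : set 'rV[R]_n)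
    (B : 'rV[R]_n -> 'M[R]_m) (eta : 'rV[R]_n -> R)
    (h : 'rV[R]_n -> 'cV[R]_m) : stoch_transf R n m :=
  StochTransf U U id id B eta h.

(* Main.v *)
(* All three equations are linear systems Y_i(F) = F A_i. The Y_i are replaced by
   the frame Z = g Y with Z P = 1 for a constant matrix P; the bracket relations
   with constant coefficients then say that the Z_a commute and that the
   transformed connection A' is flat. A solution is F(x) = Q(1), where
   w' = - v Z(w), Q' = (v . A'(w)) Q, w(0) = x, v = (x - x0) P, Q(0) = 1: the
   variational equation along Z_b has an explicit solution, whose value at time 1
   is F A'_b. As x0 is an equilibrium, the flow exists up to time 1 near x0, and
   it is smooth in x by induction over the tangent fields. The solution for
   A_i = - C_i is orthogonal because Q' = S Q with S skew; positivity of eta and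
   of det B persists from x0 to a neighborhood. *)
Require Import Defs.
From HB Require Import structures.
From mathcomp Require Import all_boot all_order all_algebra.
From mathcomp Require Import all_classical all_reals all_analysis.
From mathcomp Require Import ring lra.
Import Order.TTheory GRing.Theory Num.Theory.
Import numFieldNormedType.Exports.
Local Open Scope classical_set_scope.
Local Open Scope ring_scope.
Set Implicit Arguments.
Unset Strict Implicit.
Unset Printing Implicit Defensive.

(** * Differentiation of matrix-valued maps *)

Section Calculus.
Context {R : realType}.
Implicit Types V W : normedModType R.

(** One argument serves [B], [eta] and [h] because a span over the reals that is closed under the
    bracket gives the same constants [c i j l] in all four components: the coefficients that vanish
    for the commuting frame are also those of the curvature. Independence at [x0] enters through the
    invertibility of [Y P], which forces them to vanish.

    The formula for [F] comes from a solution that is 1 on the slice [(y - x0) P = 0]. Along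
    [w' = - v Z(w)] the product [F(w) Q] is constant, since [Q' = (v . A'(w)) Q]. It is [F(x)] at
    time 0 and [Q(1)] at time 1, when the curve meets the slice. No straightening coordinates are
    needed.

    The velocity belongs to the state, with derivative 0, so that [Q(1)] depends on [x] through
    initial conditions only. What remains is differentiability of every order in the initial
    condition, for curves that live until time 1; this is why the calculus is set up with explicit
    error bounds. *)

Lemma diff_epsE V W (f : V -> W) (x : V) (df : {linear V -> W}) :
  continuous df ->
  (forall e, 0 < e -> \forall h \near 0, `|f (h + x) - f x - df h| <= e * `|h|) ->
  differentiable f x /\ 'd f x = df :> (V -> W).
Proof.
move=> cdf H.
have E : f \o shift x = cst (f x) + df +o_ 0 id.
  apply/eqaddoP => e e0; have := H e e0; apply: filterS => h /=.
  by rewrite opprD addrA.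
by split; [apply/diff_locallyP|]; rewrite (diff_unique cdf E).
Qed.

Lemma differentiable_eps V W (f : V -> W) (x : V) : differentiable f x ->
  forall e, 0 < e ->
    \forall h \near 0, `|f (h + x) - f x - 'd f x h| <= e * `|h|.
Proof.
move=> /diff_locallyP[_ /eqaddoP H] e e0; have := H e e0; apply: filterS => h.
by rewrite /= opprD addrA.
Qed.

Lemma near_eq_differentiable V W (f g : V -> W) (x : V) :
  (\near x, f x = g x) -> differentiable f x -> differentiable g x.
Proof.
move=> fg df; apply: (@diff_epsE _ _ _ _ ('d f x) _ _).1.
  exact: diff_continuous.
move=> e e0; rewrite -(nbhs_singleton fg).
have fg' : \forall h \near 0, f (h + x) = g (h + x).
  by move: fg; rewrite (near_shift 0) /=; apply: filterS => h; rewrite subr0.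
by apply: filterS2 fg' (differentiable_eps df e0) => h ->.
Qed.

Lemma is_derive_diff V W (f : V -> W) (x v : V) :
  differentiable f x -> is_derive x v f ('d f x v).
Proof. by move=> df; apply: DeriveDef; [exact: diff_derivable|exact: deriveE]. Qed.

Lemma derive_lin V W (f : V -> W) (x : V) : differentiable f x ->
  forall a u v, 'D_(a *: u + v) f x = a *: 'D_u f x + 'D_v f x.
Proof. by move=> df a u v; rewrite !deriveE // linearP. Qed.

Lemma is_derive_chain V V' W (f : V -> V') (g : V' -> W) (x v : V) :
  differentiable f x -> differentiable g (f x) ->
  is_derive x v (g \o f) ('D_('D_v f x) g (f x)).
Proof.
move=> df dg; apply: is_derive_eq.
  exact/is_derive_diff/differentiable_comp.
by rewrite diff_comp //= !deriveE.
Qed.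

Lemma is_derive_chain1 V W (u : R -> V) (g : V -> W) (t : R) (d : V) :
  is_derive t (1 : R) u d -> differentiable g (u t) ->
  is_derive t (1 : R) (g \o u) ('D_d g (u t)).
Proof.
move=> [du <-] dg; apply: is_derive_chain => //.
exact/derivable1_diffP.
Qed.

Lemma is_derive_mxP V m n (f : V -> 'M[R]_(m, n)) (x v : V) d :
  is_derive x v f d <->
  (forall i j, is_derive x v (fun y => f y i j) (d i j)).
Proof.
split=> [[df <-] i j|H].
  apply: DeriveDef; first by move/derivable_mxP: df; exact.
  by rewrite derive_mx // mxE.
have df : derivable f x v by apply/derivable_mxP => i j; by case: (H i j).
apply: DeriveDef => //; rewrite derive_mx //.
by apply/matrixP => i j; rewrite mxE derive_val.
Qed.

Lemma is_derive_sumE V W (I : Type) (r : seq I) (h : I -> V -> W) (x v : V) dh :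
  (forall i, is_derive x v (h i) (dh i)) ->
  is_derive x v (fun y => \sum_(i <- r) h i y) (\sum_(i <- r) dh i).
Proof.
move=> H; elim: r => [|i r IH].
  under eq_fun do rewrite big_nil.
  by rewrite big_nil; exact: is_derive_cst.
under eq_fun do rewrite big_cons.
by rewrite big_cons; exact: is_deriveD.
Qed.

Lemma is_derive_mulmx V m n p (f : V -> 'M[R]_(m, n)) (g : V -> 'M[R]_(n, p))
    (x v : V) df dg :
  is_derive x v f df -> is_derive x v g dg ->
  is_derive x v (fun y => f y *m g y) (df *m g x + f x *m dg).
Proof.
move=> /is_derive_mxP hf /is_derive_mxP hg; apply/is_derive_mxP => i j.
rewrite !mxE -big_split /=.
under eq_fun do rewrite mxE.
apply: is_derive_sumE => k.
have H := is_deriveM (hf i k) (hg k j).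
apply: (is_derive_eq H).
by rewrite addrC; congr (_ + _); exact: mulrC.
Qed.

Lemma linear_continuous_mx m n W (l : {linear 'M[R]_(m, n) -> W}) : continuous l.
Proof.
have -> : (l : 'M[R]_(m, n) -> W) =
    \sum_(i < m) \sum_(j < n) (fun A : 'M[R]_(m, n) => A i j *: l (delta_mx i j)).
  apply/funext => A; rewrite [in LHS](matrix_sum_delta A) linear_sum fct_sumE.
  apply: eq_bigr => i _; rewrite linear_sum fct_sumE.
  by apply: eq_bigr => j _; rewrite linearZ.
move=> A.
have H i j : {for A, continuous (fun B : 'M[R]_(m, n) => B i j *: l (delta_mx i j))}.
  apply: (@continuous_comp _ _ _ (fun B : 'M[R]_(m, n) => B i j) ( *:%R^~ (l (delta_mx i j)))).
    exact: coord_continuous.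
  exact: scalel_continuous.
apply: differentiable_continuous.
apply: differentiable_sum => i; apply: differentiable_sum => j.
apply: (@differentiableZl _ _ _ (fun B : 'M[R]_(m, n) => B i j)).
exact: differentiable_coord.
Qed.

(** Only a directional derivative of [f] is at hand, so the chain rule for differentials does not
    apply; the difference quotient commutes with [l] instead. *)
Lemma is_derive_linear V W W' (l : {linear W -> W'}) (f : V -> W) (x v : V) d :
  continuous l -> is_derive x v f d -> is_derive x v (l \o f) (l d).
Proof.
move=> cl [/cvg_ex[/= a Ha] <-].
have E : 'D_v f x = a by apply/cvg_lim => //=.
have H : h^-1 *: ((l \o f) (h *: v + x) - (l \o f) x) @[h --> 0^'] --> l a.
  have := cvg_comp _ _ Ha (cl a).
  apply: cvg_trans; apply: near_eq_cvg; near=> h.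
  by rewrite /= linearZ linearB.
apply: DeriveDef; first by apply/cvg_ex; exists (l a).
by rewrite E; apply/cvg_lim.
Unshelve. all: by end_near. Qed.

End Calculus.

(** * Functions of class C^k *)

Section Smooth.
Context {R : realType}.
Implicit Types V W : normedModType R.

(** Functions are total but matter on [U] only; openness turns equality on [U] into equality near
    each point, where derivatives are taken. *)
Lemma Ck_on_congr V W k (U : set V) (f g : V -> W) : open U ->
  (forall x, U x -> f x = g x) -> Ck_on k U f -> Ck_on k U g.
Proof.
move=> oU; elim: k f g => [|k IH] f g fg /=.
  move=> cf x xU; have Ux : U x by rewrite inE in xU.
  have fgx : \near x, f x = g x.
    by near=> y; apply: fg; near: y; exact: open_nbhs_nbhs.
  have := cf x xU; rewrite /continuous_at fg //.
  by apply: cvg_trans; apply: near_eq_cvg.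
move=> [df Df]; split=> [x Ux|v].
  apply: near_eq_differentiable (df x Ux).
  by near=> y; apply: fg; near: y; exact: open_nbhs_nbhs.
apply: IH (Df v) => x Ux; apply: near_eq_derive.
by near=> y; apply: fg; near: y; exact: open_nbhs_nbhs.
Unshelve. all: by end_near. Qed.

Lemma Ck_on_pred V W k (U : set V) (f : V -> W) :
  Ck_on k.+1 U f -> Ck_on k U f.
Proof.
elim: k f => [|k IH] f [df Df].
  move=> x; rewrite inE => Ux.
  exact/differentiable_continuous/df.
by split=> // v; exact/IH/Df.
Qed.

Lemma Ck_on_sub V W k (U U' : set V) (f : V -> W) :
  U' `<=` U -> Ck_on k U f -> Ck_on k U' f.
Proof.
move=> sub; elim: k f => [|k IH] f /=.
  by move=> cf x; rewrite inE => /sub Ux; apply: cf; rewrite inE.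
by move=> [df Df]; split=> [x /sub|v]; [exact: df|exact/IH/Df].
Qed.

Lemma Ck_on_cst V W k (U : set V) (c : W) : Ck_on k U (cst c).
Proof.
elim: k c => [|k IH] c /=; first by move=> x _; exact: cst_continuous.
split=> [x _|v]; first exact: differentiable_cst.
rewrite (_ : 'D_v (cst c) = cst 0); first exact: IH.
by apply/funext => x; rewrite derive_cst.
Qed.

Lemma Ck_on_linear V W k (U : set V) (l : {linear V -> W}) :
  continuous l -> Ck_on k U l.
Proof.
move=> cl; case: k => [|k]; first by move=> x _; exact: cl.
split=> [x _|v]; first exact: linear_differentiable.
rewrite (_ : 'D_v l = cst (l v)); first exact: Ck_on_cst.
apply/funext => x; rewrite deriveE ?diff_lin //.
exact: linear_differentiable.
Qed.

Lemma Ck_on_add V W k (U : set V) (f g : V -> W) : open U ->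
  Ck_on k U f -> Ck_on k U g -> Ck_on k U (fun x => f x + g x).
Proof.
move=> oU; elim: k f g => [|k IH] f g /=.
  by move=> cf cg x xU; apply: continuousD; [exact: cf|exact: cg].
move=> [df Df] [dg Dg]; split=> [x Ux|v].
  by apply: differentiableD; [exact: df|exact: dg].
apply: Ck_on_congr oU _ (IH _ _ (Df v) (Dg v)) => x Ux.
by rewrite -deriveD //; apply: diff_derivable; [exact: df|exact: dg].
Qed.

Lemma Ck_on_sum V W k (U : set V) I (r : seq I) (P : pred I) (f : I -> V -> W) :
  open U -> (forall i, P i -> Ck_on k U (f i)) ->
  Ck_on k U (fun x => \sum_(i <- r | P i) f i x).
Proof.
move=> oU H; elim: r => [|i r IH].
  by under eq_fun do rewrite big_nil; exact: Ck_on_cst.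
under eq_fun do rewrite big_cons.
by case Pi : (P i) => //; apply: Ck_on_add => //; exact: H.
Qed.

Lemma Ck_on_postlin V W W' k (U : set V) (l : {linear W -> W'}) (f : V -> W) :
  open U -> continuous l -> Ck_on k U f -> Ck_on k U (l \o f).
Proof.
move=> oU cl; elim: k f => [|k IH] f /=.
  by move=> cf x xU; apply: continuous_comp; [exact: cf|exact: cl].
move=> [df Df]; split=> [x Ux|v].
  by apply: differentiable_comp; [exact: df|exact: linear_differentiable].
apply: Ck_on_congr oU _ (IH _ (Df v)) => x Ux /=.
have H := is_derive_linear cl (derivableP (@diff_derivable _ _ _ _ _ v (df x Ux))).
by rewrite [RHS]derive_val.
Qed.

(** The Leibniz rule pairs a derivative with an underived factor, hence [Ck_on_pred] to lower the
    order of the latter. *)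
Lemma Ck_on_mul V k (U : set V) (f g : V -> R) : open U ->
  Ck_on k U f -> Ck_on k U g -> Ck_on k U (fun x => f x * g x).
Proof.
move=> oU; elim: k f g => [|k IH] f g /=.
  by move=> cf cg x xU; apply: continuousM; [exact: cf|exact: cg].
move=> Hf Hg; have [df Df] := Hf; have [dg Dg] := Hg; split=> [x Ux|v].
  by apply: differentiableM; [exact: df|exact: dg].
have := Ck_on_add oU (IH _ _ (Ck_on_pred Hf) (Dg v)) (IH _ _ (Ck_on_pred Hg) (Df v)).
apply: Ck_on_congr => // x Ux.
by rewrite -[RHS]/('D_v (f * g) x) deriveM //;
  apply: diff_derivable; [exact: df|exact: dg].
Qed.

Lemma Ck_on_prod V k (U : set V) I (r : seq I) (P : pred I) (f : I -> V -> R) :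
  open U -> (forall i, P i -> Ck_on k U (f i)) ->
  Ck_on k U (fun x => \prod_(i <- r | P i) f i x).
Proof.
move=> oU H; elim: r => [|i r IH].
  by under eq_fun do rewrite big_nil; exact: Ck_on_cst.
under eq_fun do rewrite big_cons.
by case Pi : (P i) => //; apply: Ck_on_mul => //; exact: H.
Qed.

Lemma Ck_on_inv V k (U : set V) (f : V -> R) : open U ->
  (forall x, U x -> f x != 0) -> Ck_on k U f -> Ck_on k U (fun x => (f x)^-1).
Proof.
move=> oU f0; elim: k f f0 => [|k IH] f f0 /=.
  move=> cf x xU; apply: continuousV; last exact: cf.
  by apply: f0; rewrite inE in xU.
move=> Hf; have [df Df] := Hf; split=> [x Ux|v].
  by apply: differentiableV; [exact: df|exact: f0].
have H1 := IH _ f0 (Ck_on_pred Hf).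
have H2 := Ck_on_mul oU (@Ck_on_cst V R k U (-1)) (Ck_on_mul oU (Ck_on_mul oU H1 H1) (Df v)).
apply: Ck_on_congr oU _ H2 => x Ux.
rewrite deriveV ?f0 //; last exact/diff_derivable/df.
by rewrite /cst mulN1r expr2 invfM scaleNr.
Qed.

Lemma Ck_on_mxP V m n k (U : set V) (f : V -> 'M[R]_(m, n)) : open U ->
  Ck_on k U f <-> (forall i j, Ck_on k U (fun x => f x i j)).
Proof.
move=> oU; split=> [Hf i j|H].
  have lin : linear (fun A : 'M[R]_(m, n) => A i j) by move=> a A B; rewrite !mxE.
  pose l : {linear 'M[R]_(m, n) -> R} :=
    HB.pack (fun A : 'M[R]_(m, n) => A i j) (GRing.isLinear.Build _ _ _ _ _ lin).
  by apply: (@Ck_on_postlin _ _ _ _ _ l) => //; exact: coord_continuous.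
have H1 i j : Ck_on k U (fun x => f x i j *: delta_mx i j : 'M[R]_(m, n)).
  have lin : linear (fun c : R => c *: delta_mx i j : 'M[R]_(m, n)).
    by move=> a b c; rewrite scalerDl scalerA.
  pose l : {linear R -> 'M[R]_(m, n)} :=
    HB.pack (fun c : R => c *: delta_mx i j : 'M[R]_(m, n))
      (GRing.isLinear.Build _ _ _ _ _ lin).
  by apply: (@Ck_on_postlin _ _ _ _ _ l) => //; exact: scalel_continuous.
have -> : f = fun x => \sum_(i < m) \sum_(j < n) f x i j *: delta_mx i j.
  by apply/funext => x; exact: matrix_sum_delta.
by apply: Ck_on_sum => // i _; apply: Ck_on_sum.
Qed.

Lemma Ck_on_linear_mx V m n W k (U : set V) (l : {linear 'M[R]_(m, n) -> W})
    (f : V -> 'M[R]_(m, n)) : open U -> Ck_on k U f -> Ck_on k U (l \o f).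
Proof. by move=> oU; apply: Ck_on_postlin => //; exact: linear_continuous_mx. Qed.

Lemma Ck_on_opp V m n k (U : set V) (f : V -> 'M[R]_(m, n)) : open U ->
  Ck_on k U f -> Ck_on k U (fun x => - f x).
Proof. by move=> oU; exact: (@Ck_on_linear_mx _ _ _ _ _ _ (-%R)). Qed.

Lemma Ck_on_tr V m n k (U : set V) (f : V -> 'M[R]_(m, n)) : open U ->
  Ck_on k U f -> Ck_on k U (fun x => (f x)^T).
Proof. by move=> oU; exact: (@Ck_on_linear_mx _ _ _ _ _ _ trmx). Qed.

Lemma Ck_on_mulmx V m n p k (U : set V) (f : V -> 'M[R]_(m, n))
    (g : V -> 'M[R]_(n, p)) : open U ->
  Ck_on k U f -> Ck_on k U g -> Ck_on k U (fun x => f x *m g x).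
Proof.
move=> oU /(Ck_on_mxP _ _ oU) Hf /(Ck_on_mxP _ _ oU) Hg.
apply/(Ck_on_mxP _ _ oU) => i j; under eq_fun do rewrite mxE.
by apply: Ck_on_sum => // l _; exact: Ck_on_mul.
Qed.

Lemma Ck_on_scale V m n k (U : set V) (c : V -> R) (f : V -> 'M[R]_(m, n)) :
  open U -> Ck_on k U c -> Ck_on k U f -> Ck_on k U (fun x => c x *: f x).
Proof.
move=> oU Hc /(Ck_on_mxP _ _ oU) Hf.
apply/(Ck_on_mxP _ _ oU) => i j; under eq_fun do rewrite mxE.
exact: Ck_on_mul.
Qed.

Lemma Ck_on_det V n k (U : set V) (f : V -> 'M[R]_n) : open U ->
  Ck_on k U f -> Ck_on k U (fun x => \det (f x)).
Proof.
move=> oU /(Ck_on_mxP _ _ oU) Hf; apply: Ck_on_sum => // s _.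
by apply: Ck_on_mul => //; [exact: Ck_on_cst|apply: Ck_on_prod].
Qed.

Lemma Ck_on_invmx V n k (U : set V) (f : V -> 'M[R]_n) : open U ->
  (forall x, U x -> f x \in unitmx) -> Ck_on k U f ->
  Ck_on k U (fun x => invmx (f x)).
Proof.
move=> oU fu Hf.
have Ha : Ck_on k U (fun x => \adj (f x)).
  apply/(Ck_on_mxP _ _ oU) => i j; under eq_fun do rewrite mxE.
  apply: Ck_on_mul => //; first exact: Ck_on_cst.
  apply: Ck_on_det => //; apply/(Ck_on_mxP _ _ oU) => a b.
  under eq_fun do rewrite !mxE.
  by move/(Ck_on_mxP _ _ oU): Hf; exact.
(* [invmx] is given by the adjugate on units only, so the two functions are compared on [U]. *)
apply: (@Ck_on_congr _ _ _ _ (fun x => (\det (f x))^-1 *: \adj (f x))) => //.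
  by move=> x Ux; rewrite /invmx fu.
apply: Ck_on_scale => //; apply: Ck_on_inv => //.
  by move=> x Ux; have := fu x Ux; rewrite unitmxE unitfE.
exact: Ck_on_det.
Qed.

Lemma derive_sum_delta V n (g : 'rV[R]_n -> V) (x v : 'rV[R]_n) :
  differentiable g x -> 'D_v g x = \sum_(i < n) v 0 i *: 'D_('e_i) g x.
Proof.
move=> dg; rewrite deriveE // [in LHS](row_sum_delta v) linear_sum.
by apply: eq_bigr => i _; rewrite linearZ /= deriveE.
Qed.

(** In coordinates the derivative of [g \o f] is a sum of ['D_('e_i) g \o f] with coefficients from
    ['D_v f]: compositions of the same form, one order lower. *)
Lemma Ck_on_comp V n m p k (U : set V) (O : set 'rV[R]_n) (f : V -> 'rV[R]_n)
    (g : 'rV[R]_n -> 'M[R]_(m, p)) : open U -> open O ->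
  (forall x, U x -> O (f x)) -> Ck_on k U f -> Ck_on k O g ->
  Ck_on k U (g \o f).
Proof.
move=> oU oO UO; elim: k f g UO => [|k IH] f g UO /=.
  move=> cf cg x xU; apply: continuous_comp; first exact: cf.
  by apply: cg; rewrite inE; apply: UO; rewrite inE in xU.
move=> Hf Hg; have [df Df] := Hf; have [dg Dg] := Hg; split=> [x Ux|v].
  by apply: differentiable_comp; [exact: df|exact/dg/UO].
apply: (@Ck_on_congr _ _ _ _ (fun x =>
    \sum_(i < n) ('D_v f x) 0 i *: ('D_('e_i) g \o f) x)) => //.
  move=> x Ux; have H := @is_derive_chain _ _ _ _ _ _ _ v (df x Ux) (dg _ (UO x Ux)).
  by rewrite [RHS]derive_val derive_sum_delta //; exact/dg/UO.
apply: Ck_on_sum => // i _; apply: Ck_on_scale => //.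
  by move/(Ck_on_mxP _ _ oU): (Df v).
by apply: IH (Dg _) => //; exact: Ck_on_pred Hf.
Qed.

End Smooth.

(** * Gronwall inequality *)

Section ODE.
Context {R : realType}.

Lemma mx_entry_le m n (A : 'M[R]_(m, n)) i j : `|A i j| <= `|A|.
Proof.
rewrite [leRHS]/Num.Def.normr /= mx_normrE.
exact: (le_bigmax _ (fun ij : 'I_m * 'I_n => `|A ij.1 ij.2|) (i, j)).
Qed.

Lemma mx_norm_le m n (A : 'M[R]_(m, n)) c :
  0 <= c -> (forall i j, `|A i j| <= c) -> `|A| <= c.
Proof.
move=> c0 H; rewrite [leLHS]/Num.Def.normr /= mx_normrE.
by apply: bigmax_le => // -[i j] _; exact: H.
Qed.

Lemma derive_nonneg_le (f df : R -> R) (tau : R) :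
  (forall t, 0 <= t <= tau -> is_derive t (1 : R) f (df t)) ->
  (forall t, 0 <= t <= tau -> 0 <= df t) ->
  forall t, 0 <= t <= tau -> f 0 <= f t.
Proof.
move=> fd df0 t /andP[t0 tT].
have sub x : x \in `]0, tau[ -> 0 <= x <= tau.
  by rewrite in_itv /= => /andP[/ltW -> /ltW ->].
apply: (@ger0_derive1_ndecr R f 0 tau) => //.
- by move=> x /sub /fd [].
- by move=> x /sub xT; rewrite derive1E; have := fd _ xT => -[_ ->]; exact: df0.
- apply: derivable_within_continuous => x; rewrite in_itv /= => xT.
  by have [] := fd _ xT.
Qed.

(** In the max norm it suffices to bound entries, and for each entry both [G - u] and [G + u] are
    nondecreasing. *)
Lemma derive_norm_le n (u u' : R -> 'rV[R]_n) (G g : R -> R) (tau : R) :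
  (forall t, 0 <= t <= tau -> is_derive t (1 : R) u (u' t)) ->
  (forall t, 0 <= t <= tau -> is_derive t (1 : R) G (g t)) ->
  (forall t, 0 <= t <= tau -> `|u' t| <= g t) ->
  forall t, 0 <= t <= tau -> `|u t - u 0| <= G t - G 0.
Proof.
move=> ud Gd ug t tT.
have G0 : 0 <= G t - G 0.
  rewrite subr_ge0; apply: (derive_nonneg_le Gd) => // s sT.
  exact: le_trans (ug s sT).
apply: mx_norm_le => // i j; rewrite !mxE.
have ui s : 0 <= s <= tau -> is_derive s (1 : R) (fun r => u r i j) (u' s i j).
  by move=> sT; have /is_derive_mxP := ud s sT; exact.
have bnd s : 0 <= s <= tau -> `|u' s i j| <= g s.
  by move=> sT; apply: le_trans (ug s sT); exact: mx_entry_le.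
have H1 := @derive_nonneg_le (fun s => G s - u s i j) (fun s => g s - u' s i j) tau.
have H2 := @derive_nonneg_le (fun s => G s + u s i j) (fun s => g s + u' s i j) tau.
have {}H1 : G 0 - u 0 i j <= G t - u t i j.
  apply: H1 => // s sT; last first.
    by rewrite subr_ge0; have := bnd s sT; rewrite ler_norml => /andP[].
  by have := Gd s sT; have := ui s sT => ? ?; exact: is_deriveB.
have {}H2 : G 0 + u 0 i j <= G t + u t i j.
  apply: H2 => // s sT; last first.
    by have := bnd s sT; rewrite ler_norml -lerBlDl sub0r => /andP[].
  by have := Gd s sT; have := ui s sT => ? ?; exact: is_deriveD.
by rewrite ler_norml; apply/andP; split; lra.
Qed.

Lemma derivative0_const n (u : R -> 'rV[R]_n) :
  (forall t : R, 0 <= t <= 1 -> is_derive t (1 : R) u 0) ->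
  forall t : R, 0 <= t <= 1 -> u t = u 0.
Proof.
move=> ud t tT.
have HG (s : R) (_ : 0 <= s <= 1) := is_derive_cst (0 : R) s (1 : R).
have Hb (s : R) : 0 <= s <= 1 -> `|0 : 'rV[R]_n| <= 0 by rewrite normr0.
have := derive_norm_le ud HG Hb tT.
by rewrite subrr normr_le0 subr_eq0 => /eqP.
Qed.

(** The one shape of all comparison functions below: exponential for weighted estimates, linear when
    [a] and [b] are 0, or a sum of both. *)
Lemma is_derive_exp_scale (a b c : R) (t : R) :
  is_derive t (1 : R) (fun s => a * expR (b * s) + c * s) (a * b * expR (b * t) + c).
Proof.
have H1 : is_derive t (1 : R) (fun s : R => b * s) b.
  have := is_deriveZ b (is_derive_id t (1 : R)).
  by rewrite /GRing.scale /= mulr1.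
have H2 := is_derive1_comp (is_derive_expR (b * t)) H1.
have H3 := is_deriveZ a H2.
have H4 : is_derive t (1 : R) (fun s : R => c * s) c.
  have := is_deriveZ c (is_derive_id t (1 : R)).
  by rewrite /GRing.scale /= mulr1.
have := is_deriveD H3 H4.
rewrite (_ : a *: (expR (b * t) * b) = a * b * expR (b * t)) //.
by rewrite /GRing.scale /= [expR _ * b]mulrC mulrA.
Qed.

(* The norm need not be differentiable, so the bound is obtained by maximizing
   [|d t| exp(- 2 L t)]; this costs the factors 2. *)
Lemma gronwall n (d d' : R -> 'rV[R]_n) (L e tau : R) :
  0 <= tau <= 1 -> 0 < L -> 0 <= e ->
  (forall t, 0 <= t <= tau -> is_derive t (1 : R) d (d' t)) ->
  (forall t, 0 <= t <= tau -> `|d' t| <= L * `|d t| + e) ->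
  forall t, 0 <= t <= tau -> `|d t| <= 2 * expR (2 * L) * (`|d 0| + e).
Proof.
move=> /andP[tau0 tau1] L0 e0 dd dle.
pose h t := `|d t| * expR (- (2 * L) * t).
have ch : {within `[0, tau], continuous h}.
  apply: continuous_in_subspaceT => t; rewrite inE /= in_itv /= => tT.
  apply: (@continuousM _ _ (fun t => `|d t|) (fun t => expR (- (2 * L) * t))).
    apply: continuous_comp; last exact: norm_continuous.
    apply: differentiable_continuous; apply/derivable1_diffP.
    by have [] := dd t tT.
  apply: continuous_comp; last exact: continuous_expR.
  exact: mulrl_continuous.
have [c] := EVT_max tau0 ch; rewrite in_itv /= => cT hmax.
have E0 s : 0 < expR (2 * L * s) :> R by exact: expR_gt0.
have EV s : expR (- (2 * L) * s) * expR (2 * L * s) = 1 :> R.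
  by rewrite -expRD mulNr addNr expR0.
have dS t : 0 <= t <= tau -> `|d t| <= h c * expR (2 * L * t).
  move=> tT; have : h t <= h c by apply: hmax; rewrite in_itv.
  by rewrite -(ler_pM2r (E0 t)) {1}/h -[X in X <= _]mulrA EV mulr1.
have S0 : 0 <= h c by rewrite mulr_ge0 // expR_ge0.
have := @derive_norm_le _ d d' _ _ tau dd
  (fun t _ => is_derive_exp_scale (h c / 2) (2 * L) e t) _ c cT.
have H t : 0 <= t <= tau ->
    `|d' t| <= h c / 2 * (2 * L) * expR (2 * L * t) + e.
  move=> tT; apply: le_trans (dle t tT) _; rewrite lerD2r.
  have := dS t tT; rewrite -(ler_pM2l L0) => /le_trans; apply.
  by rewrite le_eqVlt; apply/orP; left; apply/eqP; field.
move=> /(_ H) Hc.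
have c0 : 0 <= c by case/andP: cT.
have c1 : c <= 1 by apply: le_trans tau1; case/andP: cT.
have {Hc} : `|d c| <= `|d 0| + h c / 2 * expR (2 * L * c) + e.
  have := ler_normD (d c - d 0) (d 0); rewrite subrK => /le_trans; apply.
  rewrite [X in _ <= X]addrAC [_ + e]addrC -addrA.
  have A1 : h c / 2 * expR (2 * L * 0) = h c / 2 by rewrite mulr0 expR0 mulr1.
  have ec : e * c <= e by rewrite ler_piMr.
  rewrite A1 in Hc; lra.
rewrite -(ler_pM2r (expR_gt0 (- (2 * L) * c))) -/(h c) => Hc.
have Ec1 : expR (- (2 * L) * c) <= 1 :> R.
  by rewrite -expR0 ler_expR mulNr oppr_le0 !mulr_ge0 // ltW.
have d0 : 0 <= `|d 0| by [].
(* The weight has rate [2 * L], so integrating [L * h c * expR (2 * L * s)] yields only half of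
   [h c], which the left-hand side absorbs. *)
have hc : h c <= 2 * (`|d 0| + e).
  have A : (`|d 0| + h c / 2 * expR (2 * L * c) + e) * expR (- (2 * L) * c) =
     (`|d 0| + e) * expR (- (2 * L) * c) + h c / 2.
    have := EV c; set x := expR _; set y := expR _ => xy.
    rewrite -[in RHS](mulr1 (h c / 2)) -xy; ring.
  rewrite A in Hc.
  have : (`|d 0| + e) * expR (- (2 * L) * c) <= `|d 0| + e.
    by rewrite ler_piMr // addr_ge0.
  lra.
move=> t tT; apply: le_trans (dS t tT) _.
have t1 : t <= 1 by apply: le_trans tau1; case/andP: tT.
have Et : expR (2 * L * t) <= expR (2 * L) :> R.
  by rewrite ler_expR ler_piMr // mulr_ge0 // ltW.
apply: (@le_trans _ _ (2 * (`|d 0| + e) * expR (2 * L))).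
  by apply: ler_pM => //; exact: expR_ge0.
by rewrite mulrAC.
Qed.

(** The intervals of radius [2 * C / 2 ^+ j] around [x j] are nested; the limit is the supremum of
    their left ends. *)
Lemma cauchy_half_real (x : nat -> R) (C : R) :
  (forall j, `|x j.+1 - x j| <= C / 2 ^+ j) ->
  exists l, forall j, `|l - x j| <= 2 * C / 2 ^+ j.
Proof.
move=> H.
have p2 j : 0 < 2 ^+ j :> R by exact: exprn_gt0.
have E j : 2 * C / 2 ^+ j.+1 = C / 2 ^+ j :> R.
  by rewrite exprS; field; rewrite gt_eqF.
have E' j : 2 * C / 2 ^+ j = 2 * (C / 2 ^+ j) :> R by rewrite mulrA.
pose a j := x j - 2 * C / 2 ^+ j; pose b j := x j + 2 * C / 2 ^+ j.
have C0 j : 0 <= C / 2 ^+ j by exact: le_trans (H j).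
have aS j : a j <= a j.+1.
  by rewrite /a E E'; have := H j; rewrite ler_norml => /andP[]; lra.
have bS j : b j.+1 <= b j.
  by rewrite /b E E'; have := H j; rewrite ler_norml => /andP[]; lra.
have am i j : (i <= j)%N -> a i <= a j.
  elim: j => [|j IH]; first by rewrite leqn0 => /eqP ->.
  rewrite leq_eqVlt => /orP[/eqP -> //|]; rewrite ltnS => /IH /le_trans; exact.
have bm i j : (i <= j)%N -> b j <= b i.
  elim: j => [|j IH]; first by rewrite leqn0 => /eqP ->.
  rewrite leq_eqVlt => /orP[/eqP -> //|]; rewrite ltnS => /IH; exact: le_trans.
have ab i j : a i <= b j.
  apply: le_trans (am _ _ (leq_maxl i j)) _.
  apply: le_trans (bm _ _ (leq_maxr i j)).
  by rewrite /a /b E'; have := C0 (maxn i j); lra.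
have ub j : ubound (range a) (b j) by move=> _ [i _ <-]; exact: ab.
exists (sup (range a)) => j.
have H1 : a j <= sup (range a).
  by apply: ub_le_sup; [exists (b 0%N); exact: ub|exists j].
have H2 : sup (range a) <= b j by apply: ge_sup; [exists (a 0%N), 0%N|exact: ub].
by rewrite ler_norml; move: H1 H2; rewrite /a /b => H1 H2; apply/andP; split; lra.
Qed.

Lemma cauchy_half n (x : nat -> 'rV[R]_n) (C : R) :
  (forall j, `|x j.+1 - x j| <= C / 2 ^+ j) ->
  exists l, forall j, `|l - x j| <= 2 * C / 2 ^+ j.
Proof.
move=> H.
have /choice[l Hl] : forall i : 'I_n, exists l,
    forall j, `|l - x j 0 i| <= 2 * C / 2 ^+ j.
  move=> i; apply: cauchy_half_real => j.
  have := H j; apply: le_trans.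
  by have := mx_entry_le (x j.+1 - x j) 0 i; rewrite !mxE.
exists (\row_i l i) => j; apply: mx_norm_le => [|i k].
  by rewrite -mulrA mulr_ge0 //; exact: le_trans (H j).
by rewrite !mxE (ord1 i); exact: Hl.
Qed.

Lemma half_lt (K e : R) : 0 < e -> exists j, K / 2 ^+ j < e.
Proof.
move=> e0; exists (Num.Def.archi_bound (K / e)).
have := @upper_nthrootP R (K / e) _ (leqnn _).
by rewrite ltr_pdivrMr // => H; rewrite ltr_pdivrMr ?exprn_gt0 // mulrC.
Qed.

End ODE.

(** * Existence of solutions *)

Section Existence.
Context {R : realType}.

Lemma exists_primitive_real (h : R -> R) : continuous h ->
  exists H : R -> R, forall t : R, 0 <= t -> is_derive t (1 : R) H (h t).
Proof.
move=> ch.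
(* Starting the integral at -1 makes 0 an interior point, so that the derivative there is
   two-sided. *)
exists (fun x => (\int[@lebesgue_measure R]_(t in `[-1, x]) h t)%R) => t t0.
have tt1 : t < t + 1 by rewrite ltrDl.
have [||dH HE] := @continuous_FTC1_closed R h (-1) t (t + 1) tt1 _ _ (ch t).
- apply: continuous_compact_integrable; first exact: segment_compact.
  exact: continuous_subspaceT.
- by rewrite (lt_le_trans _ t0) // ltrN10.
apply: DeriveDef; first exact: dH.
rewrite -derive1E.
exact: HE.
Qed.

Lemma exists_primitive n (h : R -> 'rV[R]_n) (y : 'rV[R]_n) : continuous h ->
  exists H : R -> 'rV[R]_n,
    H 0 = y /\ forall t : R, 0 <= t -> is_derive t (1 : R) H (h t).
Proof.
move=> ch.
have /choice[H Hd] : forall i : 'I_n, exists H : R -> R,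
    forall t : R, 0 <= t -> is_derive t (1 : R) H (h t 0 i).
  move=> i; apply: (@exists_primitive_real (fun t => h t 0 i)) => t.
  apply: (@continuous_comp _ _ _ h (fun A : 'rV[R]_n => A 0 i)); first exact: ch.
  exact: coord_continuous.
exists (fun t => \row_i (H i t - H i 0 + y 0 i)); split.
  by apply/rowP => i; rewrite mxE subrr add0r.
move=> t t0; apply/is_derive_mxP => i j.
under eq_fun do rewrite mxE.
rewrite (ord1 i).
have := Hd j t t0 => H1.
have := is_deriveD (is_deriveD H1 (is_derive_cst (- H j 0) t (1 : R)))
  (is_derive_cst (y 0 j) t (1 : R)).
by rewrite !addr0.
Qed.

Definition clamp01 (t : R) : R := Num.max 0 (Num.min t 1).

Lemma clamp01_itv t : 0 <= clamp01 t <= 1.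
Proof. by rewrite /clamp01 le_max lexx /= ge_max ler01 ge_min lexx orbT. Qed.

Lemma clamp01_id t : 0 <= t <= 1 -> clamp01 t = t.
Proof. by case/andP => t0 t1; rewrite /clamp01 (min_idPl t1) (max_idPr t0). Qed.

Lemma clamp01_continuous : continuous clamp01.
Proof.
move=> t; apply/(@continuous_max R R (cst 0) (id \min cst 1)).
  exact: cst_continuous.
by apply: continuous_min; [exact: cvg_id|exact: cst_continuous].
Qed.

Lemma derivable_continuous_clamp (V : normedModType R) (u u' : R -> V) :
  (forall t : R, 0 <= t <= 1 -> is_derive t (1 : R) u (u' t)) ->
  continuous (u \o clamp01).
Proof.
move=> ud t; apply: continuous_comp; first exact: clamp01_continuous.
apply: differentiable_continuous; apply/derivable1_diffP.
by have [] := ud _ (clamp01_itv t).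
Qed.

(* Picard iteration, contracting by 1/2 for the norm weighted by [exp(- 2 L t)].
   The iterates are precomposed with [clamp01] to be continuous on all of R. *)
Lemma ode_exists n (g : R -> 'rV[R]_n -> 'rV[R]_n) (L : R) (y : 'rV[R]_n) :
  0 < L ->
  (forall u, continuous u -> continuous (fun t => g t (u t))) ->
  (forall t p q, `|g t p - g t q| <= L * `|p - q|) ->
  exists u, u 0 = y /\
    forall t : R, 0 <= t <= 1 -> is_derive t (1 : R) u (g t (u t)).
Proof.
move=> L0 cg Lg.
have /choice[P HP] : forall u : R -> 'rV[R]_n, exists v : R -> 'rV[R]_n,
    continuous u -> v 0 = y /\
      forall t : R, 0 <= t <= 1 -> is_derive t (1 : R) v (g t (u t)).
  move=> u; have [cu|ncu] := pselect (continuous u); last by exists u.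
  have [v [v0 vd]] := exists_primitive y (cg u cu).
  by exists v => _; split => // t /andP[t0 _]; exact: vd.
pose x := fix x (j : nat) : R -> 'rV[R]_n :=
  if j is j'.+1 then P (x j') \o clamp01 else fun=> y.
have xS j : x j.+1 = P (x j) \o clamp01.
  by [].
have cx j : continuous (x j).
  elim: j => [|j IH]; first exact: cst_continuous.
  by have [_ Pd] := HP _ IH; rewrite xS; exact: derivable_continuous_clamp Pd.
have xcl j (t : R) : x j (clamp01 t) = x j t.
  by case: j => // j; rewrite xS /= [clamp01 (clamp01 t)]clamp01_id // clamp01_itv.
have [M HM] : exists M, forall t : R, 0 <= t <= 1 -> `|x 1%N t - x 0%N t| <= M.
  have ch : {within `[0, 1], continuous (fun t => `|x 1%N t - x 0%N t|)}.
    apply: continuous_subspaceT => t; apply: continuous_comp; last exact: norm_continuous.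
    by apply: continuousB; exact: cx.
  have [c _ Hc] := EVT_max ler01 ch.
  by exists (`|x 1%N c - x 0%N c|) => t tT; apply: Hc; rewrite in_itv.
have M0 : 0 <= M by apply: le_trans (HM 0 _) => //; rewrite lexx ler01.
have p2 j : 0 < 2 ^+ j :> R by exact: exprn_gt0.
have step j (t : R) : 0 <= t <= 1 ->
    `|x j.+1 t - x j t| <= M / 2 ^+ j * expR (2 * L * t).
  elim: j t => [|j IH] t tT.
    apply: le_trans (HM t tT) _; rewrite expr0 divr1 ler_peMr //.
    rewrite -expR0 ler_expR !mulr_ge0 //; first exact: ltW.
    by case/andP: tT.
  rewrite !xS /= clamp01_id //.
  have [P0 Pd] := HP _ (cx j); have [P1 Pd1] := HP _ (cx j.+1).
  have Hd (s : R) : 0 <= s <= 1 -> is_derive s (1 : R) (P (x j.+1) - P (x j))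
      (g s (x j.+1 s) - g s (x j s)).
    by move=> sT; have := Pd s sT; have := Pd1 s sT => ? ?; exact: is_deriveB.
  have HG (s : R) (_ : 0 <= s <= 1) :=
    is_derive_exp_scale (M / 2 ^+ j.+1) (2 * L) 0 s.
  have Hb (s : R) : 0 <= s <= 1 -> `|g s (x j.+1 s) - g s (x j s)| <=
      M / 2 ^+ j.+1 * (2 * L) * expR (2 * L * s) + 0.
    move=> sT; apply: le_trans (Lg _ _ _) _.
    apply: le_trans (_ : L * (M / 2 ^+ j * expR (2 * L * s)) <= _).
      by rewrite ler_pM2l // IH.
    rewrite le_eqVlt; apply/orP; left; apply/eqP.
    by rewrite exprS; field; rewrite gt_eqF.
  have := derive_norm_le Hd HG Hb tT; rewrite -[(P _ - P _) t]/(P _ t - P _ t).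
  rewrite -[(P _ - P _) 0]/(P _ 0 - P _ 0) P0 P1 subrr subr0 => /le_trans; apply.
  rewrite !mul0r !addr0 mulr0 expR0 mulr1 lerBlDr lerDl.
  by rewrite mulr_ge0 // invr_ge0 ltW.
pose C := M * expR (2 * L).
(* Through [clamp01] the bound holds at every real [t], and the weight is at most [expR (2 * L)]:
   the convergence is uniform on the line. *)
have stepC (t : R) j : `|x j.+1 t - x j t| <= C / 2 ^+ j.
  rewrite -xcl -[x j t]xcl; apply: le_trans (step _ _ (clamp01_itv _)) _.
  rewrite /C mulrAC; apply: ler_wpM2r; first by rewrite invr_ge0 ltW.
  apply: ler_wpM2l => //; rewrite ler_expR ler_piMr ?mulr_ge0 // ?(ltW L0) //.
  by case/andP: (clamp01_itv t).
have C0 : 0 <= C by rewrite mulr_ge0 // expR_ge0.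
have /choice[l Hl] := fun t : R => cauchy_half (stepC t).
have cl : continuous l.
  move=> t; apply/cvgrPdist_lt => e e0.
  have [j Hj] := @half_lt R (2 * C) (e / 3) (divr_gt0 e0 (ltr0Sn _ _)).
  have /cvgrPdist_lt /(_ _ (divr_gt0 e0 (ltr0Sn R 2))) := cx j t.
  apply: filterS => s Hs.
  have -> : l t - l s = (l t - x j t) + (x j t - x j s) - (l s - x j s).
    by apply/matrixP => i k; rewrite !mxE; ring.
  apply: le_lt_trans (ler_normB _ _) _.
  apply: le_lt_trans (lerD (ler_normD _ _) (lexx _)) _.
  have := Hl t j; have := Hl s j; move: Hs Hj; lra.
have [w0 wd] := HP _ cl.
(* The limit [l] is only known to be continuous, whereas [P l] has a derivative by construction; it
   remains to see that they agree on [0, 1]. *)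
exists (P l); split => // t tT.
suff E (s : R) : 0 <= s <= 1 -> P l s = l s by rewrite E //; exact: wd.
move=> {t tT} sT; apply/eqP; rewrite -subr_eq0 -normr_le0.
apply/ler_addgt0Pl => e e0; rewrite addr0.
(* The term with [L] bounds [P l - P (x j)], the other one bounds [l - x j.+1]. *)
have [j Hj] := @half_lt R (2 * C * L + 2 * C) e e0.
have [P0 Pd] := HP _ (cx j).
have Hd (r : R) : 0 <= r <= 1 -> is_derive r (1 : R) (P l - P (x j))
    (g r (l r) - g r (x j r)).
  by move=> rT; have := Pd r rT; have := wd r rT => ? ?; exact: is_deriveB.
have HG (r : R) (_ : 0 <= r <= 1) :=
  is_derive_exp_scale 0 0 (L * (2 * C / 2 ^+ j)) r.
have Hb (r : R) : 0 <= r <= 1 -> `|g r (l r) - g r (x j r)| <=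
    0 * 0 * expR (0 * r) + L * (2 * C / 2 ^+ j).
  move=> rT; rewrite !mul0r add0r; apply: le_trans (Lg _ _ _) _.
  by rewrite ler_pM2l // Hl.
have {Hb} : `|P l s - P (x j) s| <= L * (2 * C / 2 ^+ j).
  have := derive_norm_le Hd HG Hb sT; rewrite -[(P _ - P _) s]/(P _ s - P _ s).
  rewrite -[(P _ - P _) 0]/(P _ 0 - P _ 0) P0 w0 subrr subr0 => /le_trans; apply.
  rewrite !mul0r !add0r mulr0 subr0 ler_piMr //; last by case/andP: sT.
  by rewrite !mulr_ge0 // ?invr_ge0 // ltW.
move=> H; have H2 := Hl s j.+1; rewrite xS /= clamp01_id // in H2.
have E2 : 2 * C / 2 ^+ j.+1 <= 2 * C / 2 ^+ j.
  apply: ler_wpM2l; first by rewrite mulr_ge0.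
  by rewrite lef_pV2 ?posrE // exprS ler_peMl // ?ltW // ltr1n.
have E3 : (2 * C * L + 2 * C) / 2 ^+ j = L * (2 * C / 2 ^+ j) + 2 * C / 2 ^+ j.
  by rewrite mulrDl; congr (_ + _); rewrite mulrC mulrA [RHS]mulrCA; ring.
have -> : P l s - l s = (P l s - P (x j) s) - (l s - P (x j) s).
  by apply/matrixP => i k; rewrite !mxE; ring.
apply: le_trans (ler_normB _ _) _.
move: Hj; rewrite E3; lra.
Qed.

End Existence.

(** * Estimates in a tube around a curve *)

Section Tube.
Context {R : realType}.

Lemma near_normP (V : normedModType R) (x : V) (P : V -> Prop) :
  (\near x, P x) <-> exists2 d : R, 0 < d & forall y, `|y - x| < d -> P y.
Proof.
split=> [/nbhs_normP[d d0 H]|[d d0 H]].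
  by exists d => // y; rewrite distrC => /H.
by apply/nbhs_normP; exists d => // y; rewrite /= distrC => /H.
Qed.

Lemma derive_norm_sum n m (f : 'rV[R]_n -> 'rV[R]_m) (x v : 'rV[R]_n) :
  differentiable f x ->
  `|'D_v f x| <= (\sum_(i < n) `|'D_('e_i) f x|) * `|v|.
Proof.
move=> df; rewrite derive_sum_delta // mulr_suml.
apply: le_trans (ler_norm_sum _ _ _) _; apply: ler_sum => i _.
by rewrite normrZ mulrC ler_wpM2l // mx_entry_le.
Qed.

(** [Ck_on 1] makes each ['D_v f] continuous separately; the finitely many basis directions give a
    bound uniform in [v]. *)
Lemma derive_near n m (f : 'rV[R]_n -> 'rV[R]_m) (O : set 'rV[R]_n) q0 e :
  open O -> Ck_on 1 O f -> O q0 -> 0 < e ->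
  exists2 d : R, 0 < d & forall z, `|z - q0| < d ->
    O z /\ forall v, `|'D_v f z - 'D_v f q0| <= e * `|v|.
Proof.
move=> oO [df Df] Oq e0.
(* [n.+1] rather than [n] covers the case [n = 0]. *)
have e1 : 0 < e / n.+1%:R by rewrite divr_gt0.
have : \forall z \near q0, O z /\ forall i : 'I_n,
    `|'D_('e_i) f q0 - 'D_('e_i) f z| < e / n.+1%:R.
  have H1 : \near q0, O q0 by exact: open_nbhs_nbhs.
  have H2 : \forall z \near q0, forall i : 'I_n,
      `|'D_('e_i) f q0 - 'D_('e_i) f z| < e / n.+1%:R.
    apply: (@filter_forall _ 'I_n (fun i z => `|'D_('e_i) f q0 - 'D_('e_i) f z| < e / n.+1%:R) (nbhs q0) _) => i.
    have := Df 'e_i q0; rewrite inE => /(_ Oq) /cvgrPdist_lt; exact.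
  by apply: filterS2 H1 H2 => z.
move=> /near_normP[d d0 H]; exists d => // z /H[Oz Hz]; split=> // v.
have dfz := df z Oz; have dfq := df q0 Oq.
rewrite derive_sum_delta // [X in _ - X]derive_sum_delta // -sumrB.
apply: le_trans (ler_norm_sum _ _ _) _.
apply: le_trans (_ : \sum_(i < n) (e / n.+1%:R * `|v|) <= _).
  apply: ler_sum => i _; rewrite -scalerBr normrZ mulrC.
  by apply: ler_pM => //; [rewrite distrC ltW|exact: mx_entry_le].
rewrite sumr_const card_ord -[X in X <= _]mulr_natl mulrA ler_wpM2r //.
rewrite mulrCA ler_piMr //; first exact: ltW.
by rewrite ler_pdivrMr // mul1r ler_nat.
Qed.

Lemma is_derive_affine m n (q v : 'M[R]_(m, n)) (s : R) :
  is_derive s (1 : R) (fun r : R => q + r *: v) v.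
Proof.
apply/is_derive_mxP => i j; under eq_fun do rewrite !mxE mulrC.
have := is_deriveD (is_derive_cst (q i j) s (1 : R))
  (is_deriveZ (v i j) (is_derive_id s (1 : R))).
by rewrite add0r /GRing.scale /= mulr1.
Qed.

(** Mean value inequality on the segment from [q] to [p], which stays in the ball, for [f] minus its
    linear part at [q0]. *)
Lemma mean_value_near n m (f : 'rV[R]_n -> 'rV[R]_m) (q0 : 'rV[R]_n) (d e : R) :
  (forall z, `|z - q0| < d -> differentiable f z /\
     forall v, `|'D_v f z - 'D_v f q0| <= e * `|v|) ->
  forall p q, `|p - q0| < d -> `|q - q0| < d ->
    `|f p - f q - 'D_(p - q) f q0| <= e * `|p - q|.
Proof.
move=> H p q pd qd.
pose c (s : R) := q + s *: (p - q).
have cd (s : R) : 0 <= s <= 1 -> `|c s - q0| < d.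
  move=> /andP[s0 s1].
  have -> : c s - q0 = (1 - s) *: (q - q0) + s *: (p - q0).
    by apply/matrixP => i j; rewrite !mxE; ring.
  apply: le_lt_trans (ler_normD _ _) _; rewrite !normrZ !ger0_norm ?subr_ge0 //.
  have [->|sn0] := eqVneq s 0; first by rewrite mul0r addr0 subr0 mul1r.
  have sgt0 : 0 < s by rewrite lt_def sn0.
  have : s * `|p - q0| < s * d by rewrite ltr_pM2l.
  have : (1 - s) * `|q - q0| <= (1 - s) * d by rewrite ler_wpM2l ?subr_ge0 // ltW.
  lra.
have ud (s : R) : 0 <= s <= 1 -> is_derive s (1 : R)
    (fun r => f (c r) - (0 + r *: 'D_(p - q) f q0))
    ('D_(p - q) f (c s) - 'D_(p - q) f q0).
  move=> s01; have [dfc _] := H _ (cd s s01).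
  have := is_derive_chain1 (is_derive_affine q (p - q) s) dfc => ?.
  have := is_derive_affine 0 ('D_(p - q) f q0) s => ?.
  exact: is_deriveB.
have HG (s : R) (_ : 0 <= s <= 1) := is_derive_exp_scale 0 0 (e * `|p - q|) s.
have Hb (s : R) : 0 <= s <= 1 -> `|'D_(p - q) f (c s) - 'D_(p - q) f q0| <=
    0 * 0 * expR (0 * s) + e * `|p - q|.
  by move=> s01; rewrite !mul0r add0r; have [_] := H _ (cd s s01); exact.
have := derive_norm_le ud HG Hb (t := 1); rewrite lexx ler01 => /(_ isT).
rewrite !mul0r !add0r mulr0 subr0 mulr1 scale0r subr0 scale1r /c scale0r addr0.
by rewrite scale1r [q + _]addrC subrK addrAC.
Qed.

(** Compactness of [0, 1]. [P t r] stands for an estimate at time [t] with radius [r]; monotonicity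
    in [r] allows the local radii to be shrunk to a common one. *)
Lemma segment_uniform (P : R -> R -> Prop) :
  (forall t r r', 0 < r' -> r' <= r -> P t r -> P t r') ->
  (forall t0, 0 <= t0 <= 1 -> exists2 d, 0 < d & exists2 r, 0 < r &
     forall t : R, 0 <= t <= 1 -> `|t - t0| < d -> P t r) ->
  exists2 r, 0 < r & forall t : R, 0 <= t <= 1 -> P t r.
Proof.
move=> Pm Ploc.
have /compact_near_coveringP/near_covering_withinP K := @segment_compact R 0 1.
have : \forall r \near 0^'+, `[(0 : R), 1] `<=` (fun t => P t r).
  apply: K => t0; rewrite /= in_itv /= => /Ploc[d d0 [r r0 H]].
  exists ([set t | `|t - t0| < d], [set r' | 0 < r' /\ r' <= r]); first split => /=.
  - by apply: (near_normP (t0 : R) (fun t => `|t - t0| < d)).2; exists d.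
  - near=> r'; split; near: r'; [exact: nbhs_right_gt|exact: nbhs_right_le].
  move=> [t r'] [/= td [r0' rr']] t01.
  by apply: (Pm _ _ _ r0' rr'); apply: H => //; move: t01; rewrite in_itv.
move=> H; near (0 : R)^'+ => r.
exists r; first by near: r; exact: nbhs_right_gt.
move=> t t01; suff : `[(0 : R), 1] `<=` (fun t => P t r) by apply; rewrite /= in_itv.
by near: r.
Unshelve. all: by end_near. Qed.

(** First-order Taylor estimate with a radius common to the whole curve. Half of [e] pays for the
    linearization at [c t0], the other half for moving the base point of the derivative from [c t0]
    to [c t]. *)
Lemma tube_estimate n m (f : 'rV[R]_n -> 'rV[R]_m) (O : set 'rV[R]_n)
    (c : R -> 'rV[R]_n) (e : R) :
  open O -> Ck_on 1 O f ->
  (forall t : R, 0 <= t <= 1 -> O (c t) /\ {for t, continuous c}) -> 0 < e ->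
  exists2 r, 0 < r & forall t : R, 0 <= t <= 1 -> forall p, `|p - c t| < r ->
    O p /\ `|f p - f (c t) - 'D_(p - c t) f (c t)| <= e * `|p - c t|.
Proof.
move=> oO Hf Hc e0.
apply: (@segment_uniform (fun t r => forall p, `|p - c t| < r -> O p /\ _ <= _)).
  by move=> t r r' _ rr' H p pr; apply: H; exact: lt_le_trans pr rr'.
move=> t0 t01; have [Oc cc] := Hc _ t01.
have e20 : 0 < e / 2 by rewrite divr_gt0.
have [d d0 Hd] := derive_near oO Hf Oc e20.
have d20 : 0 < d / 2 by rewrite divr_gt0.
have /cvgrPdist_lt/(_ _ d20)/near_normP[d' d'0 Hd'] := cc.
exists d' => //; exists (d / 2) => // t tT td' p pd.
have ctd := Hd' _ td'; rewrite distrC in ctd.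
have pd0 : `|p - c t0| < d.
  have -> : p - c t0 = (p - c t) + (c t - c t0) by rewrite addrA subrK.
  by apply: le_lt_trans (ler_normD _ _) _; lra.
have ctd0 : `|c t - c t0| < d by lra.
have [Op _] := Hd _ pd0; split => //.
have H z : `|z - c t0| < d -> differentiable f z /\
     forall v, `|'D_v f z - 'D_v f (c t0)| <= e / 2 * `|v|.
  by move=> /Hd[Oz Dz]; split => //; case: Hf => df _; exact: df.
have M := mean_value_near H pd0 ctd0.
have [_ /(_ (p - c t)) D] := Hd _ ctd0.
set A := 'D_(p - c t) f (c t) in D *; set B := 'D_(p - c t) f (c t0) in D M.
have -> : f p - f (c t) - A = (f p - f (c t) - B) - (A - B).
  by rewrite opprB !addrA subrK.
by apply: le_trans (ler_normB _ _) _; lra.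
Qed.

Lemma derive_bound_curve n m (f : 'rV[R]_n -> 'rV[R]_m) (O : set 'rV[R]_n)
    (c : R -> 'rV[R]_n) :
  open O -> Ck_on 1 O f ->
  (forall t : R, 0 <= t <= 1 -> O (c t) /\ {for t, continuous c}) ->
  exists2 K, 0 < K & forall t : R, 0 <= t <= 1 -> forall v,
    `|'D_v f (c t)| <= K * `|v|.
Proof.
move=> oO [df Df] Hc.
pose h t := \sum_(i < n) `|'D_('e_i) f (c t)|.
have ch : {within `[0, 1], continuous h}.
  apply: continuous_in_subspaceT => t; rewrite inE /= in_itv /= => t01.
  have [Oc cc] := Hc t t01.
  rewrite /h; elim: (index_enum _) => [|i r IH].
    by rewrite /continuous_at; under eq_fun do rewrite big_nil; rewrite big_nil; exact: cvg_cst.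
  rewrite /continuous_at; under eq_fun do rewrite big_cons; rewrite big_cons.
  apply: (@cvgD _ R^o) => //.
  apply: (@continuous_comp _ _ _ (fun t => 'D_('e_i) f (c t)) Num.norm); last exact: norm_continuous.
  apply: (@continuous_comp _ _ _ c ('D_('e_i) f)); first exact: cc.
  by apply: Df; rewrite inE.
have [t1 _ Hmax] := EVT_max ler01 ch.
have h0 t : 0 <= h t by apply: sumr_ge0.
(* Adding 1 makes the constant strictly positive, as [gronwall] and [ode_exists] require. *)
exists (h t1 + 1); first by rewrite ltr_wpDl.
move=> t t01 v; apply: le_trans (derive_norm_sum _ (df _ _)) _.
  by have [] := Hc t t01.
apply: ler_wpM2r => //; apply: ler_wpDr => //; apply: Hmax; by rewrite in_itv.
Qed.

End Tube.

(** * Stability and variational equation *)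

Section Flow.
Context {R : realType}.

(* The derivatives at the end points 0 and 1 are two-sided. *)
Definition solution n (f : 'rV[R]_n -> 'rV[R]_n) (u : R -> 'rV[R]_n) : Prop :=
  forall t : R, 0 <= t <= 1 -> is_derive t (1 : R) u (f (u t)).

Definition tangent_solution n (f : 'rV[R]_n -> 'rV[R]_n) (c w : R -> 'rV[R]_n) :
    Prop :=
  forall t : R, 0 <= t <= 1 -> is_derive t (1 : R) w ('D_(w t) f (c t)).

Lemma is_derive1_continuous (V : normedModType R) (u : R -> V) t d :
  is_derive t (1 : R) u d -> {for t, continuous u}.
Proof.
by case=> du _; apply: differentiable_continuous; apply/derivable1_diffP.
Qed.

Lemma tube_lipschitz n m (f : 'rV[R]_n -> 'rV[R]_m) (O : set 'rV[R]_n)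
    (c : R -> 'rV[R]_n) :
  open O -> Ck_on 1 O f ->
  (forall t : R, 0 <= t <= 1 -> O (c t) /\ {for t, continuous c}) ->
  exists2 L, 0 < L & exists2 r, 0 < r & forall t : R, 0 <= t <= 1 ->
    forall p, `|p - c t| < r -> `|f p - f (c t)| <= L * `|p - c t|.
Proof.
move=> oO Hf Hc; have [K K0 HK] := derive_bound_curve oO Hf Hc.
have [r r0 Hr] := tube_estimate oO Hf Hc ltr01.
exists (K + 1); first by rewrite addr_gt0.
exists r => // t tT p pr; have [_ H] := Hr t tT p pr.
rewrite -[f p - f _](subrK ('D_(p - c t) f (c t))).
apply: le_trans (ler_normD _ _) _.
by rewrite mulrDl addrC lerD // HK.
Qed.

(** Gronwall applies only while [w] stays in the tube around [u] where [f] is Lipschitz. It then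
    keeps the distance below [r / 2], so there can be no first time at which the distance reaches
    [r]. *)
Lemma solution_stable n (f : 'rV[R]_n -> 'rV[R]_n) (O : set 'rV[R]_n)
    (u : R -> 'rV[R]_n) :
  open O -> Ck_on 1 O f -> solution f u ->
  (forall t : R, 0 <= t <= 1 -> O (u t)) ->
  exists2 C, 0 < C & exists2 d, 0 < d & forall w, solution f w ->
    `|w 0 - u 0| < d -> forall t : R, 0 <= t <= 1 ->
    `|w t - u t| <= C * `|w 0 - u 0|.
Proof.
move=> oO Hf su Ou.
have [|L L0 [r r0 HL]] := @tube_lipschitz _ _ f O u oO Hf.
  by move=> t tT; split; [exact: Ou|exact: is_derive1_continuous (su t tT)].
pose C := 2 * expR (2 * L).
have C0 : 0 < C by rewrite mulr_gt0 // expR_gt0.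
have C1 : 1 <= C.
  have := @expR_ge1Dx R (2 * L); rewrite /C; lra.
exists C => //; exists (r / 2 / C) => [|w sw wd]; first by rewrite !divr_gt0.
pose d t := w t - u t.
have dd (t : R) : 0 <= t <= 1 -> is_derive t (1 : R) d (f (w t) - f (u t)).
  by move=> tT; have := sw t tT; have := su t tT => ? ?; exact: is_deriveB.
have T01 (t s : R) : 0 <= t <= s -> s <= 1 -> 0 <= t <= 1.
  by move=> /andP[-> ts] s1; exact: le_trans ts s1.
have small (s : R) : 0 <= s <= 1 ->
    (forall t : R, 0 <= t <= s -> `|d t| < r) -> `|d s| <= C * `|d 0|.
  move=> sT dr.
  have ss : 0 <= s <= s by rewrite lexx andbT; case/andP: sT.
  have s1 : s <= 1 by case/andP: sT.
  have := @gronwall _ _ d (fun t => f (w t) - f (u t)) L 0 s sT L0 (lexx _) _ _ s ss.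
  rewrite addr0; apply.
    by move=> t ts; apply: dd; exact: T01 ts s1.
  by move=> t ts; rewrite addr0; apply: HL (dr t ts); exact: T01 ts s1.
have d0r : C * `|d 0| < r / 2.
  by rewrite mulrC -ltr_pdivlMr.
suff tube (t : R) : 0 <= t <= 1 -> `|d t| < r.
  move=> t tT; apply: small => // s st; apply: tube; apply: T01 st _.
  by case/andP: tT.
move=> tT; apply: contrapT => /negP; rewrite -leNgt => rd.
(* The times at which [w] is out of the tube; the clamp makes this set closed, so that it has a
   least element. *)
pose A := `[(0 : R), 1] `&` (Num.norm \o d \o clamp01) @^-1` `[r, +oo[.
have cd : continuous (Num.norm \o d \o (@clamp01 R)).
  have H := derivable_continuous_clamp dd.
  move=> s; apply: (@continuous_comp _ _ _ (d \o (@clamp01 R)) Num.norm).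
    exact: H.
  exact: norm_continuous.
have cA : compact A.
  apply: (@subclosed_compact _ _ `[(0 : R), 1]).
  - apply: closedI; first exact: interval_closed.
    apply: closed_comp; first by move=> x _; exact: cd.
    exact: interval_closed.
  - exact: segment_compact.
  - by move=> s [].
have Ane : A !=set0.
  exists t; split; rewrite /= in_itv //=.
  by rewrite clamp01_id // rd.
have [s] := compact_EVT_min Ane cA (@continuous_subspaceT _ _ _ id (fun=> cvg_id)).
rewrite inE => -[]; rewrite /= !in_itv /= => sT + smin.
rewrite clamp01_id // andbT => rds.
have below q : 0 <= q -> q < s -> `|d q| < r.
  move=> q0 qs; rewrite ltNge; apply/negP => rdq.
  have q1 : q <= 1 by apply: le_trans (ltW qs) _; case/andP: sT.
  have : s <= q.
    apply: smin; rewrite inE; split; rewrite /= in_itv /= ?q0 //.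
    by rewrite clamp01_id ?q0 // rdq.
  by rewrite leNgt qs.
have d0 : `|d 0| <= C * `|d 0| by rewrite ler_peMl.
have s0 : 0 < s.
  rewrite lt_def; case/andP: sT => -> _; rewrite andbT; apply/eqP => s0.
  by move: rds; rewrite s0; lra.
have r2 : 0 < r / 2 by rewrite divr_gt0.
have /cvgrPdist_lt/(_ _ r2)/near_normP[e e0 He] := is_derive1_continuous (dd _ sT).
(* A time just before [s], close enough that [d] moves by less than [r / 2]; at [q] the distance is
   still below [r / 2]. *)
pose q := Num.max 0 (s - e / 2).
have q0 : 0 <= q by rewrite le_max lexx.
have qs : q < s by rewrite gt_max s0 ltrBlDr ltrDl divr_gt0.
have qe : `|q - s| < e.
  rewrite distrC gtr0_norm ?subr_gt0 // ltrBlDr addrC -ltrBlDr lt_max.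
  by apply/orP; right; lra.
have q1 : 0 <= q <= 1 by rewrite q0 (le_trans (ltW qs)) //; case/andP: sT.
have dq : `|d q| <= C * `|d 0|.
  apply: small => // t' /andP[t0 tq]; apply: below => //; exact: le_lt_trans tq qs.
have := He q qe; have := ler_normD (d s - d q) (d q); rewrite subrK.
by move: dq d0r rds; lra.
Qed.

Lemma derive_dirB (V W : normedModType R) (f : V -> W) (x p q : V) :
  differentiable f x -> 'D_(p - q) f x = 'D_p f x - 'D_q f x.
Proof. by move=> df; rewrite !deriveE // linearB. Qed.

(** The variational equation is linear, hence globally Lipschitz with the bound of the derivative
    along [c] as constant. *)
Lemma tangent_exists n (f : 'rV[R]_n -> 'rV[R]_n) (O : set 'rV[R]_n)
    (c c' : R -> 'rV[R]_n) v :
  open O -> Ck_on 1 O f ->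
  (forall t : R, 0 <= t <= 1 -> O (c t) /\ is_derive t (1 : R) c (c' t)) ->
  exists w, w 0 = v /\ tangent_solution f c w.
Proof.
move=> oO Hf Hc.
have Hc' (t : R) : 0 <= t <= 1 -> O (c t) /\ {for t, continuous c}.
  by move=> /Hc[Oc /is_derive1_continuous].
have [K K0 HK] := derive_bound_curve oO Hf Hc'.
have [df Df] := Hf.
have cc : continuous (c \o (@clamp01 R)).
  by apply: (@derivable_continuous_clamp _ _ _ c') => t /Hc[].
have dfc (t : R) : differentiable f (c (clamp01 t)).
  by apply: df; have [] := Hc _ (clamp01_itv t).
have [|t p q|w [w0 wd]] := @ode_exists _ _ (fun t p => 'D_p f (c (clamp01 t))) K v K0.
- move=> u cu t.
  have -> : (fun t => 'D_(u t) f (c (clamp01 t))) =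
      fun t => \sum_(i < n) u t 0 i *: 'D_('e_i) f (c (clamp01 t)).
    by apply/funext => s; rewrite derive_sum_delta.
  elim: (index_enum _) => [|i r IH].
    by rewrite /continuous_at; under eq_fun do rewrite big_nil; rewrite big_nil; exact: cvg_cst.
  rewrite /continuous_at; under eq_fun do rewrite big_cons; rewrite big_cons.
  apply: cvgD => //; apply: cvgZ.
    apply: (@continuous_comp _ _ _ u (fun A : 'rV[R]_n => A 0 i)); first exact: cu.
    exact: coord_continuous.
  apply: (@continuous_comp _ _ _ (c \o (@clamp01 R)) ('D_('e_i) f)); first exact: cc.
  by apply: Df; rewrite inE; have [] := Hc _ (clamp01_itv t).
- have -> : 'D_p f (c (clamp01 t)) - 'D_q f (c (clamp01 t)) =
      'D_(p - q) f (c (clamp01 t)).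
    by rewrite derive_dirB.
  by apply: HK; exact: clamp01_itv.
- exists w; split=> // t tT; have := wd t tT; by rewrite clamp01_id.
Qed.

Lemma tangent_unique n (f : 'rV[R]_n -> 'rV[R]_n) (O : set 'rV[R]_n)
    (c w1 w2 : R -> 'rV[R]_n) :
  open O -> Ck_on 1 O f ->
  (forall t : R, 0 <= t <= 1 -> O (c t) /\ {for t, continuous c}) ->
  tangent_solution f c w1 -> tangent_solution f c w2 -> w1 0 = w2 0 ->
  forall t : R, 0 <= t <= 1 -> w1 t = w2 t.
Proof.
move=> oO Hf Hc s1 s2 w0 t tT.
have [K K0 HK] := derive_bound_curve oO Hf Hc.
have [df Df] := Hf.
pose d := w1 - w2.
have dd (s : R) : 0 <= s <= 1 -> is_derive s (1 : R) d ('D_(d s) f (c s)).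
  move=> sT; have := s1 s sT; have := s2 s sT => ? ?.
  have -> : 'D_(d s) f (c s) = 'D_(w1 s) f (c s) - 'D_(w2 s) f (c s).
    have dfc : differentiable f (c s) by apply: df; have [] := Hc s sT.
    by rewrite derive_dirB.
  exact: is_deriveB.
have T11 : 0 <= (1 : R) <= 1 by rewrite lexx ler01.
have Hb (s : R) : 0 <= s <= 1 -> `|'D_(d s) f (c s)| <= K * `|d s| + 0.
  by move=> sT; rewrite addr0; exact: HK.
have := gronwall T11 K0 (lexx _) dd Hb tT.
have -> : d 0 = 0 by apply/eqP; rewrite subr_eq0 w0.
by rewrite normr0 addr0 mulr0 normr_le0 subr_eq0 => /eqP.
Qed.

End Flow.

(** * Smooth dependence on initial conditions *)

Section SmoothFlow.
Context {R : realType}.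

(** [phi] is an arbitrary choice of one solution per starting point; its regularity in [y] is
    proved, not assumed. *)
Definition flow_on n (f : 'rV[R]_n -> 'rV[R]_n) (O D : set 'rV[R]_n)
    (phi : 'rV[R]_n -> R -> 'rV[R]_n) : Prop :=
  forall y, D y -> [/\ phi y 0 = y, solution f (phi y) &
    forall t : R, 0 <= t <= 1 -> O (phi y t)].

(** The remainder [D'] of the linearization solves the variational equation up to an error small
    against the distance of the two solutions, hence against [|h|] by stability; Gronwall carries
    this to time [t0]. *)
Lemma flow_derive n (f : 'rV[R]_n -> 'rV[R]_n) (O D : set 'rV[R]_n) phi :
  open O -> open D -> Ck_on 1 O f -> flow_on f O D phi ->
  forall (y : 'rV[R]_n) (t : R), D y -> 0 <= t <= 1 ->
  differentiable (phi^~ t) y /\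
  forall w, tangent_solution f (phi y) w -> 'D_(w 0) (phi^~ t) y = w t.
Proof.
move=> oO oD Hf Hphi y0 t0 Dy t0T.
have [df Df] := Hf.
have [p0 sp Op] := Hphi _ Dy.
have Hc' (t : R) : 0 <= t <= 1 -> O (phi y0 t) /\ {for t, continuous (phi y0)}.
  by move=> tT; split; [exact: Op|exact: is_derive1_continuous (sp t tT)].
have Hc (t : R) : 0 <= t <= 1 ->
    O (phi y0 t) /\ is_derive t (1 : R) (phi y0) (f (phi y0 t)).
  by move=> tT; split; [exact: Op|exact: sp].
have /choice[w Hw] := fun v => @tangent_exists _ _ _ _ _ _ v oO Hf Hc.
have uniq := tangent_unique oO Hf Hc'.
(* Linearity in the initial vector comes from uniqueness: a combination of tangent solutions is
   again one. *)
have wlin : linear (fun v => w v t0).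
  move=> a u v.
  have [wu su] := Hw u; have [wv sv] := Hw v; have [wuv suv] := Hw (a *: u + v).
  have S : tangent_solution f (phi y0) (fun t => a *: w u t + w v t).
    move=> t tT; rewrite derive_lin; last by apply: df; exact: Op.
    by have := su t tT; have := sv t tT => ? ?; apply: is_deriveD.
  by apply: uniq suv S _ _ t0T; rewrite wuv wu wv.
pose L : {linear 'rV[R]_n -> 'rV[R]_n} :=
  HB.pack (fun v => w v t0) (GRing.isLinear.Build _ _ _ _ _ wlin).
have [C C0 [d d0 HC]] := solution_stable oO Hf sp Op.
have [K K0 HK] := derive_bound_curve oO Hf Hc'.
pose E := 2 * expR (2 * K).
have E0 : 0 < E by rewrite mulr_gt0 // expR_gt0.
have [||dphi Edphi] := @diff_epsE _ _ _ (phi^~ t0) y0 L.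
- exact: linear_continuous_mx.
- move=> e e0.
  (* Stability costs the factor [C] and Gronwall the factor [E], which leaves exactly [e]. *)
  have e1 : 0 < e / (E * C) by rewrite divr_gt0 // mulr_gt0.
  have [r r0 Hr] := tube_estimate oO Hf Hc' e1.
  have nD : \forall h \near (0 : 'rV[R]_n), D (h + y0).
    have : \near y0, D y0 by exact: open_nbhs_nbhs.
    by rewrite (near_shift 0) /=; apply: filterS => h; rewrite subr0.
  have nd : \forall h \near (0 : 'rV[R]_n), `|h| < d.
    by apply/near_normP; exists d => // h; rewrite subr0.
  have nr : \forall h \near (0 : 'rV[R]_n), `|h| < r / C.
    by apply/near_normP; exists (r / C); rewrite ?divr_gt0 // => h; rewrite subr0.
  near=> h.
  have Dh : D (h + y0) by near: h.
  have hd : `|h| < d by near: h.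
  have hr : `|h| < r / C by near: h.
  have [q0 sq Oq] := Hphi _ Dh.
  have st : forall t : R, 0 <= t <= 1 -> `|phi (h + y0) t - phi y0 t| <= C * `|h|.
    by have := HC _ sq; rewrite q0 p0 addrK; apply.
  have [wh0 wh] := Hw h.
  pose D' t := phi (h + y0) t - phi y0 t - w h t.
  have dD (t : R) : 0 <= t <= 1 -> is_derive t (1 : R) D'
      (f (phi (h + y0) t) - f (phi y0 t) - 'D_(w h t) f (phi y0 t)).
    move=> tT; have := sq t tT; have := sp t tT; have := wh t tT => ? ? ?.
    by apply: is_deriveB; exact: is_deriveB.
  have T11 : 0 <= (1 : R) <= 1 by rewrite lexx ler01.
  have Hb (t : R) : 0 <= t <= 1 ->
      `|f (phi (h + y0) t) - f (phi y0 t) - 'D_(w h t) f (phi y0 t)| <=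
      K * `|D' t| + e / E * `|h|.
    move=> tT.
    have rt : `|phi (h + y0) t - phi y0 t| < r.
      by apply: le_lt_trans (st t tT) _; rewrite mulrC -ltr_pdivlMr.
    have [_ H] := Hr t tT _ rt.
    set a := f _ - f _ in H *.
    have -> : a - 'D_(w h t) f (phi y0 t) =
        (a - 'D_(phi (h + y0) t - phi y0 t) f (phi y0 t)) + 'D_(D' t) f (phi y0 t).
      rewrite (@derive_dirB _ _ _ _ _ (phi (h + y0) t - phi y0 t)); last by apply: df; exact: Op.
      by rewrite addrA subrK.
    apply: le_trans (ler_normD _ _) _; rewrite addrC; apply: lerD; first exact: HK.
    apply: le_trans H _.
    apply: le_trans (_ : e / (E * C) * (C * `|h|) <= _).
      by rewrite ler_pM2l // st.
    rewrite le_eqVlt; apply/orP; left; apply/eqP.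
    by field; rewrite !gt_eqF.
  have eh0 : 0 <= e / E * `|h| by rewrite mulr_ge0 // divr_ge0 // ltW.
  have := gronwall T11 K0 eh0 dD Hb t0T.
  have -> : D' 0 = 0 by rewrite /D' q0 p0 wh0 addrK subrr.
  move=> /le_trans; apply; rewrite normr0 add0r -/E le_eqVlt.
  by apply/orP; left; apply/eqP; field; rewrite gt_eqF.
split=> // w' sw'; rewrite deriveE // Edphi /=.
have [w0 sw] := Hw (w' 0).
exact: uniq sw sw' w0 _ t0T.
Unshelve. all: by end_near. Qed.

Lemma Ck_on_row_mx (V : normedModType R) m n1 n2 k (U : set V)
    (f : V -> 'M[R]_(m, n1)) (g : V -> 'M[R]_(m, n2)) : open U ->
  Ck_on k U f -> Ck_on k U g -> Ck_on k U (fun x => row_mx (f x) (g x)).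
Proof.
move=> oU Hf Hg.
apply: (@Ck_on_congr _ _ _ _ _ (fun x => f x *m row_mx 1%:M 0 + g x *m row_mx 0 1%:M)) => //.
  by move=> x _; rewrite !mul_mx_row !mulmx1 !mulmx0 add_row_mx addr0 add0r.
by apply: Ck_on_add => //; apply: Ck_on_mulmx => //; exact: Ck_on_cst.
Qed.

Lemma is_derive_row_mx (V : normedModType R) m n1 n2
    (f : V -> 'M[R]_(m, n1)) (g : V -> 'M[R]_(m, n2)) (x v : V) df dg :
  is_derive x v f df -> is_derive x v g dg ->
  is_derive x v (fun y => row_mx (f y) (g y)) (row_mx df dg).
Proof.
move=> /is_derive_mxP Hf /is_derive_mxP Hg; apply/is_derive_mxP => i j.
by under eq_fun do rewrite mxE; rewrite mxE; case: (fintype.split j).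
Qed.

Lemma Ck_on_id (V : normedModType R) k (U : set V) : Ck_on k U (fun x => x).
Proof. by apply: (@Ck_on_linear _ _ _ _ _ idfun) => x; exact: cvg_id. Qed.

Lemma Ck_on_lsubmx (V : normedModType R) m n1 n2 k (U : set V)
    (f : V -> 'M[R]_(m, n1 + n2)) : open U ->
  Ck_on k U f -> Ck_on k U (fun x => lsubmx (f x)).
Proof. by move=> oU; exact: (@Ck_on_linear_mx _ _ _ _ _ _ _ lsubmx). Qed.

Lemma Ck_on_rsubmx (V : normedModType R) m n1 n2 k (U : set V)
    (f : V -> 'M[R]_(m, n1 + n2)) : open U ->
  Ck_on k U f -> Ck_on k U (fun x => rsubmx (f x)).
Proof. by move=> oU; exact: (@Ck_on_linear_mx _ _ _ _ _ _ _ rsubmx). Qed.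

(** The complete lift of [f] to the tangent bundle: its solutions pair a solution of [f] with a
    solution of the variational equation along it. *)
Definition tangent_field n (f : 'rV[R]_n -> 'rV[R]_n) (z : 'rV[R]_(n + n)) :
    'rV[R]_(n + n) :=
  row_mx (f (lsubmx z)) ('D_(rsubmx z) f (lsubmx z)).

Lemma open_lsubmx n1 n2 (O : set 'rV[R]_n1) : open O ->
  open [set z : 'rV[R]_(n1 + n2) | O (lsubmx z)].
Proof.
move=> oO; apply: (@open_comp _ _ (lsubmx : 'rV[R]_(n1 + n2) -> 'rV[R]_n1)) => //.
by move=> x _; exact: continuous_lsubmx.
Qed.

Lemma smooth_tangent_field n (f : 'rV[R]_n -> 'rV[R]_n) (O : set 'rV[R]_n) :
  open O -> smooth_on O f ->
  smooth_on [set z | O (lsubmx z)] (tangent_field f).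
Proof.
move=> oO Hf k; have oO' := @open_lsubmx n n _ oO.
have Hl := Ck_on_lsubmx oO' (@Ck_on_id _ k [set z : 'rV[R]_(n + n) | O (lsubmx z)]).
have Hr := Ck_on_rsubmx oO' (@Ck_on_id _ k [set z : 'rV[R]_(n + n) | O (lsubmx z)]).
apply: Ck_on_row_mx => //; first exact: (Ck_on_comp oO' oO).
apply: (@Ck_on_congr _ _ _ _ _
  (fun z => \sum_(i < n) rsubmx z 0 i *: ('D_('e_i) f \o lsubmx) z)) => //.
  by move=> z Oz; rewrite [RHS]derive_sum_delta //; have [df _] := Hf 1%N; exact: df.
apply: Ck_on_sum => // i _; apply: Ck_on_scale => //.
  by move/(Ck_on_mxP _ _ oO'): Hr; exact.
by apply: (Ck_on_comp oO' oO) => //; have [_ Df] := Hf k.+1; exact: Df.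
Qed.

(* [D_v phi_t] is a component of the flow of the tangent field, so that C^k
   dependence for all fields gives C^(k+1) dependence. *)
Lemma smooth_flow k n (f : 'rV[R]_n -> 'rV[R]_n) (O D : set 'rV[R]_n) phi :
  open O -> open D -> smooth_on O f -> flow_on f O D phi ->
  forall t : R, 0 <= t <= 1 -> Ck_on k D (phi^~ t).
Proof.
elim: k n f O D phi => [|k IH] n f O D phi oO oD Hf Hphi t tT /=.
  move=> y; rewrite inE => Dy; apply: differentiable_continuous.
  by have [] := flow_derive oO oD (Hf 1%N) Hphi Dy tT.
split=> [y Dy|v]; first by have [] := flow_derive oO oD (Hf 1%N) Hphi Dy tT.
(* A tangent solution for each pair of a point and a vector; 0 is a placeholder for points outside
   [D]. *)
have /choice[w Hw] : forall z : 'rV[R]_(n + n), exists w : R -> 'rV[R]_n,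
    D (lsubmx z) -> w 0 = rsubmx z /\ tangent_solution f (phi (lsubmx z)) w.
  move=> z; have [Dz|] := pselect (D (lsubmx z)); last by exists (fun=> 0).
  have [p0 sp Op] := Hphi _ Dz.
  have [|w Hw] := @tangent_exists _ _ f O (phi (lsubmx z)) (f \o phi (lsubmx z)) (rsubmx z) oO (Hf 1%N).
    by move=> s sT; split; [exact: Op|exact: sp].
  by exists w.
pose psi z s : 'rV[R]_(n + n) := row_mx (phi (lsubmx z) s) (w z s).
have oD' := @open_lsubmx n n _ oD.
have Hpsi : flow_on (tangent_field f) [set z | O (lsubmx z)] [set z | D (lsubmx z)] psi.
  move=> z Dz; have [p0 sp Op] := Hphi _ Dz; have [w0 sw] := Hw z Dz; split.
  - by rewrite /psi p0 w0 hsubmxK.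
  - move=> s sT; rewrite /tangent_field /psi row_mxKl row_mxKr.
    by apply: is_derive_row_mx; [exact: sp|exact: sw].
  - by move=> s sT; rewrite /= /psi row_mxKl; exact: Op.
have H := IH _ _ _ _ _ (@open_lsubmx n n _ oO) oD' (smooth_tangent_field oO Hf) Hpsi t tT.
apply: (@Ck_on_congr _ _ _ _ _ ((fun z => rsubmx (psi z t)) \o (fun y => row_mx y v))) => //.
  move=> y Dy; rewrite /= /psi row_mxKr.
  have [|w0 sw] := Hw (row_mx y v); first by rewrite row_mxKl.
  rewrite row_mxKl in sw; rewrite row_mxKr in w0.
  by have [_ /(_ _ sw)] := flow_derive oO oD (Hf 1%N) Hphi Dy tT; rewrite w0.
apply: (Ck_on_comp oD oD').
- by move=> y Dy /=; rewrite row_mxKl.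
- by apply: Ck_on_row_mx => //; [exact: Ck_on_id|exact: Ck_on_cst].
- exact: Ck_on_rsubmx.
Qed.

End SmoothFlow.

(** * Flow near an equilibrium *)

Section Equilibrium.
Context {R : realType}.

(** In the max norm a closed ball is a box, and clamping each coordinate is a 1-Lipschitz retraction
    onto it. *)
Definition clamp_box n (c : 'rV[R]_n) (r : R) (p : 'rV[R]_n) : 'rV[R]_n :=
  \row_i Num.max (c 0 i - r) (Num.min (p 0 i) (c 0 i + r)).

Lemma clamp_real_lipschitz (a b p q : R) :
  `|Num.max a (Num.min p b) - Num.max a (Num.min q b)| <= `|p - q|.
Proof.
wlog pq : p q / p <= q.
  move=> H; have [/H//|/ltW/H] := leP p q.
  by rewrite distrC [`|q - p|]distrC.
rewrite distrC [`|p - q|]distrC [X in _ <= X]ger0_norm ?subr_ge0 //.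
rewrite ler_norml; apply/andP; split;
  case: (leP p b) => ?; case: (leP q b) => ?; case: (leP a p) => ?;
  case: (leP a q) => ?; case: (leP a b) => ?; lra.
Qed.

Lemma clamp_box_lipschitz n (c : 'rV[R]_n) r p q :
  `|clamp_box c r p - clamp_box c r q| <= `|p - q|.
Proof.
apply: mx_norm_le => // i j; rewrite !mxE; apply: le_trans (clamp_real_lipschitz _ _ _ _) _.
by have := mx_entry_le (p - q) 0 j; rewrite !mxE.
Qed.

Lemma clamp_box_norm n (c : 'rV[R]_n) r p : 0 <= r -> `|clamp_box c r p - c| <= r.
Proof.
move=> r0; apply: mx_norm_le => // i j; rewrite !mxE (ord1 i).
rewrite ler_norml; apply/andP; split.
  by rewrite lerBrDl le_max lexx.
by rewrite lerBlDl ge_max ge_min lexx orbT andbT lerD2l; lra.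
Qed.

Lemma clamp_box_id n (c : 'rV[R]_n) r p : `|p - c| <= r -> clamp_box c r p = p.
Proof.
move=> pr; apply/rowP => i; rewrite mxE.
have := le_trans (mx_entry_le (p - c) 0 i) pr.
rewrite !mxE ler_norml => /andP[H1 H2].
rewrite min_l; last by lra.
by rewrite max_r //; lra.
Qed.

(** Clamping the argument makes [f] globally Lipschitz. By comparison with the constant solution
    [z0], a solution that starts within [r / C] stays within [r], where the clamp is the
    identity. *)
Lemma equilibrium_flow n (f : 'rV[R]_n -> 'rV[R]_n) (O : set 'rV[R]_n) z0 :
  open O -> Ck_on 1 O f -> O z0 -> f z0 = 0 ->
  exists D phi, [/\ open D, D z0 & flow_on f O D phi].
Proof.
move=> oO Hf Oz f0; have [df Df] := Hf.
have [d d0 Hd] := derive_near oO Hf Oz ltr01.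
pose L := \sum_(i < n) `|'D_('e_i) f z0| + 1.
have L0 : 0 < L by rewrite ltr_wpDl // sumr_ge0.
have lip p q : `|p - z0| < d -> `|q - z0| < d -> `|f p - f q| <= L * `|p - q|.
  move=> pd qd.
  have H z : `|z - z0| < d -> differentiable f z /\
      forall v, `|'D_v f z - 'D_v f z0| <= 1 * `|v|.
    by move=> /Hd[Oz' Dz]; split => //; exact: df.
  have := mean_value_near H pd qd => M.
  rewrite -[f p - f q](subrK ('D_(p - q) f z0)).
  apply: le_trans (ler_normD _ _) _; rewrite mulrDl addrC lerD //.
  by apply: derive_norm_sum; exact: df.
pose r := d / 2.
have r0 : 0 < r by rewrite divr_gt0.
have rd : r < d by rewrite /r; lra.
pose g (t : R) p := f (clamp_box z0 r p).
have cld p : `|clamp_box z0 r p - z0| < d.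
  by apply: le_lt_trans (clamp_box_norm _ _ (ltW r0)) rd.
have Lg (t : R) p q : `|g t p - g t q| <= L * `|p - q|.
  apply: le_trans (lip _ _ (cld p) (cld q)) _.
  by rewrite ler_pM2l // clamp_box_lipschitz.
pose C := 2 * expR (2 * L).
have C0 : 0 < C by rewrite mulr_gt0 // expR_gt0.
have cg u : continuous u -> continuous (fun t => g t (u t)).
  move=> cu t; apply/cvgrPdist_lt => e e0.
  have e1 : 0 < e / L by rewrite divr_gt0.
  have /cvgrPdist_lt/(_ _ e1) := cu t; apply: filterS => s Hs.
  by apply: le_lt_trans (Lg t _ _) _; rewrite mulrC -ltr_pdivlMr.
have /choice[phi Hphi] := fun y => @ode_exists _ _ g L y L0 cg Lg.
exists [set y | `|y - z0| < r / C], phi; split.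
- rewrite (_ : mkset _ = ball z0 (r / C)); first by apply: ball_open; rewrite divr_gt0.
  by rewrite -ball_normE; apply/seteqP; split => y /=; rewrite distrC.
- by rewrite /= subrr normr0 divr_gt0.
- move=> y /= yd; have [p0 pd] := Hphi y.
  have T11 : 0 <= (1 : R) <= 1 by rewrite lexx ler01.
  have dd (t : R) : 0 <= t <= 1 -> is_derive t (1 : R) (fun t => phi y t - z0) (g t (phi y t)).
    move=> tT; have := pd t tT => ?.
    by rewrite -[g _ _]subr0; apply: is_deriveB.
  have Hb (t : R) : 0 <= t <= 1 -> `|g t (phi y t)| <= L * `|phi y t - z0| + 0.
    move=> tT; rewrite addr0; have := Lg t (phi y t) z0.
    by rewrite {2}/g clamp_box_id ?f0 ?subr0 // subrr normr0 ltW.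
  have Hr (t : R) : 0 <= t <= 1 -> `|phi y t - z0| <= r.
    move=> tT; apply: le_trans (gronwall T11 L0 (lexx _) dd Hb tT) _.
    by rewrite p0 addr0 -/C mulrC -ler_pdivlMr // ltW.
  split=> // t tT.
    by have := pd t tT; rewrite /g clamp_box_id //; exact: Hr.
  by have [] := Hd (phi y t) (le_lt_trans (Hr t tT) rd).
Qed.

End Equilibrium.

(** * Integration along a commuting frame *)

Section Frame.
Context {R : realType}.

Lemma is_derive_lmx (V : normedModType R) m n m' n'
    (l : {linear 'M[R]_(m, n) -> 'M[R]_(m', n')}) (f : V -> 'M[R]_(m, n)) x v d :
  is_derive x v f d -> is_derive x v (fun y => l (f y)) (l d).
Proof. by move=> H; apply: is_derive_linear H; exact: linear_continuous_mx. Qed.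

Lemma derive_dir_sum (V W : normedModType R) k (f : V -> W) (x : V)
    (c : 'I_k -> R) (u : 'I_k -> V) : differentiable f x ->
  'D_(\sum_(a < k) c a *: u a) f x = \sum_(a < k) c a *: 'D_(u a) f x.
Proof.
move=> df; rewrite deriveE // linear_sum; apply: eq_bigr => a _.
by rewrite linearZ deriveE.
Qed.

Lemma is_derive_scale (V : normedModType R) m n (c : V -> R)
    (f : V -> 'M[R]_(m, n)) x v dc df :
  is_derive x v c dc -> is_derive x v f df ->
  is_derive x v (fun y => c y *: f y) (dc *: f x + c x *: df).
Proof.
move=> Hc /is_derive_mxP Hf; apply/is_derive_mxP => i j.
under eq_fun do rewrite mxE.
have H := is_deriveM Hc (Hf i j); apply: (is_derive_eq H).
by rewrite !mxE addrC; congr (_ + _); exact: mulrC.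
Qed.

Context (n k p : nat) (Z : 'rV[R]_n -> 'M[R]_(k, n)) (A : 'I_k -> 'rV[R]_n -> 'M[R]_p).

(** The connection form evaluated on the tangent vector [v *m Z w]. *)
Definition conn (v : 'rV[R]_k) (w : 'rV[R]_n) : 'M[R]_p :=
  \sum_(a < k) v 0 a *: A a w.

(* A state [(w, v, Q)] packed into one row vector: a point, a velocity in frame
   coordinates, and a parallel-transported matrix. *)
Notation state := 'rV[R]_(n + (k + p * p)).
Definition state_pt (z : state) : 'rV[R]_n := lsubmx z.
Definition state_vel (z : state) : 'rV[R]_k := lsubmx (rsubmx z).
Definition state_fib (z : state) : 'M[R]_p := vec_mx (rsubmx (rsubmx z)).
Definition mk_state (w : 'rV[R]_n) (v : 'rV[R]_k) (Q : 'M[R]_p) : state :=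
  row_mx w (row_mx v (mxvec Q)).

Lemma state_ptK w v Q : state_pt (mk_state w v Q) = w.
Proof. by rewrite /state_pt /mk_state row_mxKl. Qed.
Lemma state_velK w v Q : state_vel (mk_state w v Q) = v.
Proof. by rewrite /state_vel /mk_state row_mxKr row_mxKl. Qed.
Lemma state_fibK w v Q : state_fib (mk_state w v Q) = Q.
Proof. by rewrite /state_fib /mk_state !row_mxKr mxvecK. Qed.

Lemma is_derive_state_pt (V : normedModType R) (f : V -> state) x v d :
  is_derive x v f d -> is_derive x v (fun y => state_pt (f y)) (state_pt d).
Proof. exact: (@is_derive_lmx _ _ _ _ _ lsubmx). Qed.

Lemma is_derive_state_vel (V : normedModType R) (f : V -> state) x v d :
  is_derive x v f d -> is_derive x v (fun y => state_vel (f y)) (state_vel d).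
Proof.
move=> /(@is_derive_lmx _ _ _ _ _ rsubmx); exact: (@is_derive_lmx _ _ _ _ _ lsubmx).
Qed.

Lemma is_derive_state_fib (V : normedModType R) (f : V -> state) x v d :
  is_derive x v f d -> is_derive x v (fun y => state_fib (f y)) (state_fib d).
Proof.
move=> /(@is_derive_lmx _ _ _ _ _ rsubmx) /(@is_derive_lmx _ _ _ _ _ rsubmx).
exact: (@is_derive_lmx _ _ _ _ _ vec_mx).
Qed.

Lemma is_derive_mk_state (V : normedModType R) (w : V -> 'rV[R]_n) (v : V -> 'rV[R]_k)
    (Q : V -> 'M[R]_p) x u dw dv dQ :
  is_derive x u w dw -> is_derive x u v dv -> is_derive x u Q dQ ->
  is_derive x u (fun y => mk_state (w y) (v y) (Q y)) (mk_state dw dv dQ).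
Proof.
move=> Hw Hv HQ; apply: is_derive_row_mx => //; apply: is_derive_row_mx => //.
exact: (@is_derive_lmx _ _ _ _ _ mxvec).
Qed.

Definition radial_field (z : state) : state :=
  mk_state (- (state_vel z *m Z (state_pt z))) 0 (conn (state_vel z) (state_pt z) *m state_fib z).

Context (M : set 'rV[R]_n) (openM : open M) (smoothZ : smooth_on M Z)
  (smoothA : forall a, smooth_on M (A a)).

Let dZ x : M x -> differentiable Z x.
Proof. by move=> Mx; have [d _] := smoothZ 1%N; exact: d. Qed.

Let dA a x : M x -> differentiable (A a) x.
Proof. by move=> Mx; have [d _] := smoothA a 1%N; exact: d. Qed.

Lemma smooth_radial_field : smooth_on [set z | M (state_pt z)] radial_field.
Proof.
move=> l; have oO := @open_lsubmx _ n (k + p * p) _ openM.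
have H0 := @Ck_on_id _ _ l [set z : state | M (state_pt z)].
have H1 := Ck_on_lsubmx oO H0.
have Hr := Ck_on_rsubmx oO H0.
have H2 := Ck_on_lsubmx oO Hr.
have H3 := Ck_on_linear_mx vec_mx oO (Ck_on_rsubmx oO Hr).
apply: Ck_on_row_mx => //.
  apply: Ck_on_opp => //; apply: Ck_on_mulmx => //.
  exact: (Ck_on_comp oO openM).
apply: Ck_on_row_mx => //; first exact: Ck_on_cst.
apply: (Ck_on_linear_mx mxvec) => //.
apply: Ck_on_mulmx => //; apply: Ck_on_sum => // a _; apply: Ck_on_scale => //.
  by move/(Ck_on_mxP _ _ oO): H2; exact.
by apply: (Ck_on_comp oO openM) => //; exact: smoothA.
Qed.

Lemma derive_radial_field (z d : state) : M (state_pt z) ->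
  'D_d radial_field z = mk_state
    (- (state_vel d *m Z (state_pt z) + state_vel z *m 'D_(state_pt d) Z (state_pt z))) 0
    ((conn (state_vel d) (state_pt z)
       + \sum_(a < k) state_vel z 0 a *: 'D_(state_pt d) (A a) (state_pt z)) *m state_fib z
     + conn (state_vel z) (state_pt z) *m state_fib d).
Proof.
move=> Mz.
have H0 := is_derive_id z d.
have H1 := is_derive_state_pt H0.
have H2 := is_derive_state_vel H0.
have H3 := is_derive_state_fib H0.
have chain m' n' (g : 'rV[R]_n -> 'M[R]_(m', n')) : differentiable g (state_pt z) ->
    is_derive z d (fun y => g (state_pt y)) ('D_(state_pt d) g (state_pt z)).
  move=> dg; have := @is_derive_chain _ _ _ _ (fun y : state => state_pt y) g z d.
  rewrite (@derive_val _ _ _ _ _ _ _ H1); apply => //.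
  exact: differentiable_lsubmx.
have HZ := is_derive_mulmx H2 (chain _ _ _ (dZ Mz)).
have HA : is_derive z d (fun y => conn (state_vel y) (state_pt y))
    (conn (state_vel d) (state_pt z)
       + \sum_(a < k) state_vel z 0 a *: 'D_(state_pt d) (A a) (state_pt z)).
  rewrite /conn -big_split /=; apply: is_derive_sumE => a.
  apply: is_derive_scale; last exact/chain/dA.
  by move/is_derive_mxP: H2; exact.
have HQ := is_derive_mulmx HA H3.
have H := is_derive_mk_state (is_deriveN HZ) (is_derive_cst 0 z d) HQ.
exact: (@derive_val _ _ _ _ _ _ _ H).
Qed.

Context
  (commZ : forall x a b, M x ->
    row b ('D_(row a (Z x)) Z x) = row a ('D_(row b (Z x)) Z x))
  (flatA : forall x a b, M x ->
    'D_(row a (Z x)) (A b) x - 'D_(row b (Z x)) (A a) x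
      + (A a x *m A b x - A b x *m A a x) = 0).

Let commZ_vel x b v : M x ->
  row b ('D_(v *m Z x) Z x) = v *m 'D_(row b (Z x)) Z x.
Proof.
move=> Mx; rewrite mulmx_sum_row derive_dir_sum; last exact: dZ.
rewrite linear_sum mulmx_sum_row; apply: eq_bigr => a _.
by rewrite linearZ /= commZ.
Qed.

(** Flatness contracted with [v]: it exchanges the derivative of [A b] along the curve for
    derivatives of the [A a] along [Z_b]. *)
Let flatA_vel x b v : M x ->
  'D_(v *m Z x) (A b) x + conn v x *m A b x
  = \sum_(a < k) v 0 a *: 'D_(row b (Z x)) (A a) x + A b x *m conn v x.
Proof.
move=> Mx; rewrite mulmx_sum_row derive_dir_sum; last exact: dA.
have -> : conn v x *m A b x = \sum_(a < k) v 0 a *: (A a x *m A b x).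
  by rewrite /conn mulmx_suml; apply: eq_bigr => a _; rewrite scalemxAl.
have -> : A b x *m conn v x = \sum_(a < k) v 0 a *: (A b x *m A a x).
  by rewrite /conn mulmx_sumr; apply: eq_bigr => a _; rewrite scalemxAr.
rewrite -!big_split; apply: eq_bigr => a _ /=; rewrite -!scalerDr; congr (_ *: _).
by apply/subr0_eq; rewrite -[RHS](flatA a b Mx) opprD addrACA.
Qed.

(** Differentiating [F(w) Q = F(x)] along [Z_b], where [w] moves by [(1 - t) Z_b], and cancelling
    [F(w)] suggests the matrix part. It vanishes at time 0 if [Q] is 1 there, and is [Q *m A b x] at
    time 1. *)
Definition tangent_lift b (x : 'rV[R]_n) (u : R -> state) (t : R) : state :=
  mk_state ((1 - t) *: row b (Z (state_pt (u t)))) 'e_b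
    (- ((1 - t) *: (A b (state_pt (u t)) *m state_fib (u t))) + state_fib (u t) *m A b x).

(* Varying the starting point of a radial curve along [Z_b] moves the curve by
   [(1 - t) Z_b], because the [Z_a] commute and the velocity changes by [e_b].
   The matrix component solves its variational equation by flatness of [A]. *)
Lemma tangent_lift_solution b x u :
  solution radial_field u -> (forall t : R, 0 <= t <= 1 -> M (state_pt (u t))) ->
  tangent_solution radial_field u (tangent_lift b x u).
Proof.
move=> su Mu t tT; have Mt := Mu t tT.
rewrite derive_radial_field // !state_ptK !state_velK state_fibK.
have ut := su t tT.
set w := state_pt (u t) in Mt *; set v := state_vel (u t); set Q := state_fib (u t).
have Hw : is_derive t (1 : R) (fun s => state_pt (u s)) (- (v *m Z w)).
  by have := is_derive_state_pt ut; rewrite state_ptK.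
have HQ : is_derive t (1 : R) (fun s => state_fib (u s)) (conn v w *m Q).
  by have := is_derive_state_fib ut; rewrite state_fibK.
have Ht : is_derive t (1 : R) (fun s : R => 1 - s) (-1).
  by have := is_deriveB (is_derive_cst (1 : R) t (1 : R)) (is_derive_id t (1 : R));
    rewrite sub0r.
have HZ := is_derive_chain1 Hw (dZ Mt).
have HA := is_derive_chain1 Hw (dA b Mt).
have dN m' n' (g : 'rV[R]_n -> 'M[R]_(m', n')) : differentiable g w ->
    'D_(- (v *m Z w)) g w = - 'D_(v *m Z w) g w.
  by move=> dg; rewrite !deriveE // linearN.
rewrite dN in HZ; last exact: dZ.
rewrite dN in HA; last exact: dA.
have dsc m' n' (g : 'rV[R]_n -> 'M[R]_(m', n')) : differentiable g w ->
    'D_((1 - t) *: row b (Z w)) g w = (1 - t) *: 'D_(row b (Z w)) g w.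
  by move=> dg; rewrite !deriveE // linearZ.
have e1 := is_derive_scale Ht (is_derive_lmx (row b) HZ).
have e3 := is_deriveD
  (is_deriveN (is_derive_scale Ht (is_derive_mulmx HA HQ)))
  (is_derive_mulmx HQ (is_derive_cst (A b x) t (1 : R))).
have H := is_derive_mk_state e1 (is_derive_cst ('e_b) t (1 : R)) e3.
apply: (is_derive_eq H); congr mk_state.
  rewrite -rowE dsc; last exact: dZ.
  rewrite linearN /= commZ_vel // -scalemxAr.
  by rewrite scaleN1r scalerN opprD.
have -> : conn 'e_b w = A b w.
  rewrite /conn (bigD1 b) //= mxE !eqxx scale1r big1 ?addr0 // => a ab.
  by rewrite mxE eqxx (negbTE ab) scale0r.
have -> : \sum_(a < k) v 0 a *: 'D_((1 - t) *: row b (Z w)) (A a) w =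
    (1 - t) *: \sum_(a < k) v 0 a *: 'D_(row b (Z w)) (A a) w.
  rewrite scaler_sumr; apply: eq_bigr => a _; rewrite dsc; last exact: dA.
  by rewrite !scalerA mulrC.
have := flatA_vel b v Mt.
set X := 'D_ _ _ _; set Y := \sum_(a < k) _; set S := conn v w.
rewrite /comp /cst -/w => XE.
(* Flatness eliminates the derivative of [A b] along the curve; what is left is an identity between
   matrix products. *)
have {XE} -> : X = Y + A b w *m S - S *m A b w by rewrite -XE addrK.
rewrite !mulNmx !mulmxDl mulNmx mulmxDr mulmxN -!scalemxAl -!scalemxAr !mulmxA mulmx0.
set X1 := Y *m Q; set X2 := A b w *m S *m Q; set X3 := S *m A b w *m Q.
set X4 := A b w *m Q; set X5 := S *m Q *m _.
by apply/matrixP => i j; rewrite !mxE; ring.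
Qed.

End Frame.

(** * Solution of a flat linear system along the frame *)

Section Integrate.
Context {R : realType}.

Lemma radial_skew_orthogonal n k p (Z : 'rV[R]_n -> 'M[R]_(k, n))
    (A : 'I_k -> 'rV[R]_n -> 'M[R]_p) (M : set 'rV[R]_n)
    (u : R -> 'rV[R]_(n + (k + p * p))) :
  solution (radial_field Z A) u -> state_fib (u 0) = 1%:M ->
  (forall t : R, 0 <= t <= 1 -> M (state_pt (u t))) ->
  (forall a x, M x -> Defs.skew (A a x)) ->
  forall t : R, 0 <= t <= 1 -> state_fib (u t) *m (state_fib (u t))^T = 1%:M.
Proof.
(* As [S] multiplies [Q] on the left, it is [Q^T Q] whose derivative [Q^T (S^T + S) Q] cancels; the
   other product follows for square matrices. *)
move=> su u0 Mu skA t tT; apply: mulmx1C.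
have skc v w : M w -> (conn A v w)^T = - conn A v w.
  move=> Mw; rewrite /conn linear_sum /= -sumrN; apply: eq_bigr => a _.
  by rewrite linearZ /= (skA a w Mw) scalerN.
pose g s := (state_fib (u s))^T *m state_fib (u s).
have gd (s : R) : 0 <= s <= 1 -> is_derive s (1 : R) (fun s => mxvec (g s)) 0.
  move=> sT; have HQ := is_derive_state_fib (su s sT); rewrite state_fibK in HQ.
  have H := is_derive_lmx mxvec (is_derive_mulmx (is_derive_lmx trmx HQ) HQ).
  apply: (is_derive_eq H).
  rewrite /= trmx_mul skc; last exact: Mu.
  by rewrite mulmxN mulNmx mulmxA addNr linear0.
have := derivative0_const gd tT; rewrite /g u0 trmx1 mulmx1.
by move/(can_inj mxvecK).
Qed.

Lemma integrate_frame n k p (Z : 'rV[R]_n -> 'M[R]_(k, n))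
    (A : 'I_k -> 'rV[R]_n -> 'M[R]_p) (M : set 'rV[R]_n) (x0 : 'rV[R]_n)
    (P : 'M[R]_(n, k)) :
  open M -> M x0 -> smooth_on M Z -> (forall a, smooth_on M (A a)) ->
  (forall x, M x -> Z x *m P = 1%:M) ->
  (forall x a b, M x ->
    row b ('D_(row a (Z x)) Z x) = row a ('D_(row b (Z x)) Z x)) ->
  (forall x a b, M x ->
    'D_(row a (Z x)) (A b) x - 'D_(row b (Z x)) (A a) x
      + (A a x *m A b x - A b x *m A a x) = 0) ->
  exists (U : set 'rV[R]_n) (F : 'rV[R]_n -> 'M[R]_p),
    [/\ open U, U x0, U `<=` M & smooth_on U F] /\
    [/\ F x0 = 1%:M,
        forall x a, U x -> 'D_(row a (Z x)) F x = F x *m A a x &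
        (forall a x, M x -> Defs.skew (A a x)) ->
          forall x, U x -> F x *m (F x)^T = 1%:M].
Proof.
move=> oM Mx0 sZ sA ZP cZ fA.
pose O : set 'rV[R]_(n + (k + p * p)) := [set z | M (state_pt z)].
have oO : open O by exact: open_lsubmx.
have sf : smooth_on O (radial_field Z A) by exact: smooth_radial_field.
(* With velocity [(x - x0) P], the radial curve from [x] reaches the slice
   [(y - x0) P = 0] at time 1; for [x = x0] it is an equilibrium. *)
pose iota (x : 'rV[R]_n) : 'rV[R]_(n + (k + p * p)) := mk_state x ((x - x0) *m P) 1%:M.
have Oz0 : O (iota x0) by rewrite /O /= state_ptK.
have f0 : radial_field Z A (iota x0) = 0.
  rewrite /radial_field !state_ptK !state_velK subrr mul0mx mul0mx oppr0.
  rewrite /conn big1 => [|a _]; last by rewrite mxE scale0r.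
  by rewrite mul0mx /mk_state linear0 !row_mx0.
have [D [phi [oD Dz0 flow]]] := equilibrium_flow oO (sf 1%N) Oz0 f0.
have T1 : 0 <= (1 : R) <= 1 by rewrite lexx ler01.
have Mio x : D (iota x) -> M x.
  move=> /flow[p0 _ /(_ 0)]; rewrite lexx ler01 => /(_ isT).
  by rewrite p0 /O /= state_ptK.
have siota k' U : open U -> Ck_on k' U iota.
  move=> oU; have Hid := @Ck_on_id _ _ k' U.
  apply: Ck_on_row_mx => //; apply: Ck_on_row_mx => //; last exact: Ck_on_cst.
  apply: Ck_on_mulmx => //; last exact: Ck_on_cst.
  by apply: Ck_on_add => //; exact: Ck_on_cst.
have iota_d x : differentiable iota x by have [d _] := siota 1%N setT openT; exact: d.
pose U := iota @^-1` D.
have oU : open U.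
  apply: open_comp => // x _; exact: differentiable_continuous.
exists U, (fun x => state_fib (phi (iota x) 1)); split; split => //.
- move=> l; have H := smooth_flow l oO oD sf flow T1.
  apply: (@Ck_on_linear_mx _ _ _ _ _ _ _ vec_mx) => //.
  do 2 apply: Ck_on_rsubmx => //.
  exact: (Ck_on_comp oU oD _ (siota l U oU) H).
- have [p0 sp Op] := flow _ Dz0.
  (* Stability at initial distance 0 serves as uniqueness: the chosen solution from [iota x0] agrees
     with the constant one on [0, 1]. *)
  have [C _ [d d0 HC]] := solution_stable oO (sf 1%N) sp Op.
  have scst : solution (radial_field Z A) (cst (iota x0)).
    by move=> t _; rewrite /= f0; exact: is_derive_cst.
  have := HC _ scst; rewrite p0 /= subrr normr0 => /(_ d0 1 T1).
  by rewrite mulr0 normr_le0 subr_eq0 => /eqP <-; rewrite state_fibK.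
- move=> x b Ux; have Mx := Mio x Ux; have [p0 sp Op] := flow _ Ux.
  have [dphi Hphi] := flow_derive oO oD (sf 1%N) flow Ux T1.
  have tl := tangent_lift_solution sZ sA cZ fA b x sp Op.
  have := Hphi _ tl.
  have -> : tangent_lift Z A b x (phi (iota x)) 0 =
      mk_state (row b (Z x)) 'e_b 0.
    rewrite /tangent_lift p0 state_ptK state_fibK subr0 !scale1r.
    by rewrite mulmx1 mul1mx addNr.
  move=> E.
  (* Since [Z x *m P = 1], moving [x] along [Z_b] changes the velocity by ['e_b]; the result is the
     initial value of the tangent lift. *)
  have Di : is_derive x (row b (Z x)) iota (mk_state (row b (Z x)) 'e_b 0).
    have H := is_derive_id x (row b (Z x)).
    have H1 : is_derive x (row b (Z x)) (fun y => (y - x0) *m P) 'e_b.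
      have H1 := is_derive_lmx (mulmxr P)
        (is_deriveB H (is_derive_cst x0 x (row b (Z x)))).
      apply: (is_derive_eq H1).
      by rewrite /= subr0 -row_mul ZP // rowE mulmx1.
    apply: is_derive_mk_state => //.
  have := @is_derive_chain _ _ _ _ iota (phi^~ 1) x (row b (Z x)) (iota_d x) dphi.
  rewrite (@derive_val _ _ _ _ _ _ _ Di) E => H.
  have H2 := is_derive_state_fib H.
  rewrite (@derive_val _ _ _ _ _ _ _ H2) /tangent_lift state_fibK subrr scale0r.
  by rewrite oppr0 add0r.
- move=> skA x Ux; have [p0 sp Op] := flow _ Ux.
  by apply: radial_skew_orthogonal sp _ Op skA _ T1; rewrite p0 state_fibK.
Qed.

End Integrate.

(** * Involutive systems *)

Section System.
Context {R : realType}.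

(** Stated for an abstract family [X] so that the bracket ([X = Y], [B = 0]) and the curvature
    ([X = A], [B] the commutators) receive literally the same coefficients on the right. *)
Lemma curvature_change n k r s (g : 'rV[R]_n -> 'M[R]_k)
    (Y : 'I_k -> 'rV[R]_n) (X : 'I_k -> 'rV[R]_n -> 'M[R]_(r, s))
    (B : 'I_k -> 'I_k -> 'M[R]_(r, s)) (c : 'I_k -> 'I_k -> 'I_k -> R) x a b :
  let u a := \sum_(i < k) g x a i *: Y i in
  differentiable g x -> (forall l, differentiable (X l) x) ->
  (forall i j, 'D_(Y i) (X j) x - 'D_(Y j) (X i) x + B i j
     = \sum_(l < k) c i j l *: X l x) ->
  'D_(u a) (fun y => \sum_(l < k) g y b l *: X l y) x
    - 'D_(u b) (fun y => \sum_(l < k) g y a l *: X l y) x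
    + \sum_(i < k) \sum_(j < k) (g x a i * g x b j) *: B i j
  = \sum_(l < k) ('D_(u a) g x b l - 'D_(u b) g x a l
      + \sum_(i < k) \sum_(j < k) g x a i * g x b j * c i j l) *: X l x.
Proof.
move=> u dg dX HB.
have D v d : 'D_v (fun y => \sum_(l < k) g y d l *: X l y) x =
    \sum_(l < k) 'D_v g x d l *: X l x + \sum_(l < k) g x d l *: 'D_v (X l) x.
  have dgv := derivableP (@diff_derivable _ _ _ _ _ v dg).
  have dXv l := derivableP (@diff_derivable _ _ _ _ _ v (dX l)).
  have H := is_derive_sumE (index_enum 'I_k) (fun l =>
    is_derive_scale ((is_derive_mxP _ _ _ _).1 dgv d l) (dXv l)).
  by rewrite (@derive_val _ _ _ _ _ _ _ H) big_split.
have S1 : \sum_(l < k) g x b l *: 'D_(u a) (X l) x =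
    \sum_(i < k) \sum_(j < k) (g x a i * g x b j) *: 'D_(Y i) (X j) x.
  rewrite exchange_big /=; apply: eq_bigr => j _.
  rewrite derive_dir_sum // scaler_sumr; apply: eq_bigr => i _.
  by rewrite scalerA mulrC.
have S2 : \sum_(l < k) g x a l *: 'D_(u b) (X l) x =
    \sum_(i < k) \sum_(j < k) (g x a i * g x b j) *: 'D_(Y j) (X i) x.
  apply: eq_bigr => i _.
  rewrite derive_dir_sum // scaler_sumr; apply: eq_bigr => j _.
  by rewrite scalerA.
have S3 : \sum_(l < k) (\sum_(i < k) \sum_(j < k) g x a i * g x b j * c i j l) *: X l x =
    \sum_(i < k) \sum_(j < k) (g x a i * g x b j) *: 'D_(Y i) (X j) x
    - \sum_(i < k) \sum_(j < k) (g x a i * g x b j) *: 'D_(Y j) (X i) x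
    + \sum_(i < k) \sum_(j < k) (g x a i * g x b j) *: B i j.
  rewrite -sumrB -big_split /=.
  transitivity (\sum_(l < k) \sum_(i < k) \sum_(j < k)
      (g x a i * g x b j * c i j l) *: X l x).
    by apply: eq_bigr => l _; rewrite scaler_suml; apply: eq_bigr => i _; rewrite scaler_suml.
  rewrite exchange_big /=; apply: eq_bigr => i _.
  rewrite exchange_big /= -sumrB -big_split /=; apply: eq_bigr => j _.
  rewrite -scalerBr -scalerDr HB scaler_sumr; apply: eq_bigr => l _.
  by rewrite scalerA.
transitivity (\sum_(l < k) ('D_(u a) g x b l *: X l x - 'D_(u b) g x a l *: X l x)
    + \sum_(l < k) (\sum_(i < k) \sum_(j < k) g x a i * g x b j * c i j l) *: X l x).
  rewrite (etrans (D (u a) b) (congr1 _ S1)) (etrans (D (u b) a) (congr1 _ S2)).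
  by rewrite [X in _ = X + _]sumrB [X in _ = _ + X]S3 opprD addrACA -[LHS]addrA.
by rewrite -big_split; apply: eq_bigr => l _; rewrite scalerDl scalerBl.
Qed.

Definition frame_gauge n k (Y : 'I_k -> 'rV[R]_n -> 'rV[R]_n) (P : 'M[R]_(n, k))
    (x : 'rV[R]_n) : 'M[R]_k := invmx ((\matrix_(i < k) Y i x) *m P).

Definition frame n k (Y : 'I_k -> 'rV[R]_n -> 'rV[R]_n) (P : 'M[R]_(n, k))
    (x : 'rV[R]_n) : 'M[R]_(k, n) := frame_gauge Y P x *m \matrix_(i < k) Y i x.

Lemma row_frame n k (Y : 'I_k -> 'rV[R]_n -> 'rV[R]_n) (P : 'M[R]_(n, k)) x a :
  row a (frame Y P x) = \sum_(i < k) frame_gauge Y P x a i *: Y i x.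
Proof.
rewrite /frame row_mul mulmx_sum_row; apply: eq_bigr => i _.
by rewrite rowK mxE.
Qed.

Lemma frame_exists n k (Y : 'I_k -> 'rV[R]_n -> 'rV[R]_n) (M : set 'rV[R]_n)
    (x0 : 'rV[R]_n) :
  open M -> M x0 -> (forall i, smooth_on M (Y i)) ->
  free [tuple Y i x0 | i < k] ->
  exists (P : 'M[R]_(n, k)) (N : set 'rV[R]_n),
    [/\ open N, N x0, N `<=` M &
      forall x, N x -> (\matrix_(i < k) Y i x) *m P \in unitmx].
Proof.
move=> oM Mx0 sY fr.
pose Ym x := \matrix_(i < k) Y i x.
have sYm l : Ck_on l M Ym.
  apply/(Ck_on_mxP _ _ oM) => i j; under eq_fun do rewrite mxE.
  by have /(Ck_on_mxP _ _ oM) := sY i l; exact.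
have fY0 : row_free (Ym x0).
  rewrite -kermx_eq0; apply/rowV0P => v /sub_kermxP vY; apply/rowP => i.
  rewrite mxE; move/freeP: fr; apply; rewrite -[RHS]vY mulmx_sum_row.
  by apply: eq_bigr => j _; rewrite rowK -tnth_nth tnth_mktuple.
(* A right inverse, as the rows are independent: [Y P] is 1 at [x0], hence invertible nearby. *)
pose P := pinvmx (Ym x0).
have YP0 : Ym x0 *m P = 1%:M by exact: mulmxVp.
pose G x := Ym x *m P.
have sG l : Ck_on l M G by apply: Ck_on_mulmx => //; exact: Ck_on_cst.
have [N [[oN Nx0] NG]] : exists N, open_nbhs x0 N /\
    N `<=` [set x | M x /\ G x \in unitmx].
  have H1 : \near x0, M x0 by exact: open_nbhs_nbhs.
  have H2 : \forall x \near x0, \det (G x) != 0.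
    have cG : {for x0, continuous (fun x => \det (G x))}.
      by have := Ck_on_det oM (sG 0%N); apply; rewrite inE.
    have d1 : \det (G x0) != 0 by rewrite /G YP0 det1 oner_neq0.
    exact: cvgr_neq0 cG d1.
  have : nbhs x0 [set x | M x /\ G x \in unitmx].
    by apply: filterS2 H1 H2 => x Mx dx; split => //; rewrite unitmxE unitfE.
  by rewrite nbhsE => -[N oN sN]; exists N.
by exists P, N; split => //; move=> x /NG[].
Qed.

Lemma smooth_frame n k (Y : 'I_k -> 'rV[R]_n -> 'rV[R]_n) (N : set 'rV[R]_n)
    (P : 'M[R]_(n, k)) :
  open N -> (forall i, smooth_on N (Y i)) ->
  (forall x, N x -> (\matrix_(i < k) Y i x) *m P \in unitmx) ->
  smooth_on N (frame_gauge Y P) /\ smooth_on N (frame Y P).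
Proof.
move=> oN sY Gu.
have sYm l : Ck_on l N (fun x => \matrix_(i < k) Y i x).
  apply/(Ck_on_mxP _ _ oN) => i j; under eq_fun do rewrite mxE.
  by have /(Ck_on_mxP _ _ oN) := sY i l; exact.
have sg l : Ck_on l N (frame_gauge Y P).
  apply: Ck_on_invmx => //; apply: Ck_on_mulmx => //; exact: Ck_on_cst.
by split=> l; [exact: sg|apply: Ck_on_mulmx].
Qed.

(* [[Z_a, Z_b]] is a combination [mu] of the [Y_l], killed by [P] since [Z P] is
   constant; hence [mu = 0]. The curvature of [A'] has the same coefficients. *)
Lemma frame_flat n k p (Y : 'I_k -> 'rV[R]_n -> 'rV[R]_n)
    (A : 'I_k -> 'rV[R]_n -> 'M[R]_p) (c : 'I_k -> 'I_k -> 'I_k -> R)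
    (N : set 'rV[R]_n) (P : 'M[R]_(n, k)) :
  open N -> (forall i, smooth_on N (Y i)) -> (forall i, smooth_on N (A i)) ->
  (forall x, N x -> (\matrix_(i < k) Y i x) *m P \in unitmx) ->
  (forall x i j, N x ->
    vf_bracket (Y i) (Y j) x = \sum_(l < k) c i j l *: Y l x) ->
  (forall x i j, N x ->
    vf_act (Y i) (A j) x - vf_act (Y j) (A i) x + commutator (A i x) (A j x)
    = \sum_(l < k) c i j l *: A l x) ->
  let g := frame_gauge Y P in let Z := frame Y P in
  let A' a x := \sum_(i < k) g x a i *: A i x in
  forall x a b, N x ->
    row b ('D_(row a (Z x)) Z x) = row a ('D_(row b (Z x)) Z x) /\
    'D_(row a (Z x)) (A' b) x - 'D_(row b (Z x)) (A' a) x
    + (A' a x *m A' b x - A' b x *m A' a x) = 0.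
Proof.
move=> oN sY sA Gu br fl g Z A'.
have [sg sZ] := smooth_frame oN sY Gu.
pose Ym x := \matrix_(i < k) Y i x.
have ZP x : N x -> Z x *m P = 1%:M.
  by move=> Nx; rewrite /Z -mulmxA mulVmx // Gu.
have rowZ x a : row a (Z x) = \sum_(i < k) g x a i *: Y i x by exact: row_frame.
have dg x : N x -> differentiable g x by have [d _] := sg 1%N; exact: d.
have dZ x : N x -> differentiable Z x by have [d _] := sZ 1%N; exact: d.
have dY i x : N x -> differentiable (Y i) x by have [d _] := sY i 1%N; exact: d.
have dA i x : N x -> differentiable (A i) x by have [d _] := sA i 1%N; exact: d.
clearbody Z g.
have rowDZ x v b : N x ->
    row b ('D_v Z x) = 'D_v (fun y => \sum_(l < k) g y b l *: Y l y) x.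
  move=> Nx; have H := is_derive_lmx (row b) (derivableP (@diff_derivable _ _ _ _ _ v (dZ x Nx))).
  rewrite -(@derive_val _ _ _ _ _ _ _ H).
  by congr ('D_v _ x); apply/funext => y; exact: rowZ.
pose mu x a b : 'rV[R]_k := \row_l ('D_(row a (Z x)) g x b l
  - 'D_(row b (Z x)) g x a l
  + \sum_(i < k) \sum_(j < k) g x a i * g x b j * c i j l).
have muE x a b : N x -> row b ('D_(row a (Z x)) Z x) - row a ('D_(row b (Z x)) Z x)
    = mu x a b *m Ym x.
  move=> Nx; rewrite !rowDZ // !rowZ.
  have := @curvature_change n k 1 n g (Y^~ x) Y (fun _ _ => 0) c x a b (dg x Nx)
    (fun l => dY l x Nx).
  have -> : \sum_(i < k) \sum_(j < k) (g x a i * g x b j) *: (0 : 'rV[R]_n) = 0.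
    by rewrite big1 // => i _; rewrite big1 // => j _; rewrite scaler0.
  move=> H; rewrite -[LHS]addr0; apply: (etrans (H _)).
    by move=> i j; rewrite addr0 -(br x i j Nx).
  rewrite mulmx_sum_row; apply: eq_bigr => l _.
  by rewrite rowK /mu mxE !rowZ.
have mu0 x a b : N x -> mu x a b = 0.
  move=> Nx.
  have DZP v : 'D_v Z x *m P = 0.
    have H := is_derive_lmx (mulmxr P) (derivableP (@diff_derivable _ _ _ _ _ v (dZ x Nx))).
    rewrite -[LHS]/(mulmxr P ('D_v Z x)) -(@derive_val _ _ _ _ _ _ _ H).
    (* [Z P] is known to be constant on [N] only, which is enough near [x]. *)
    rewrite -(@derive_cst _ _ _ (1%:M : 'M[R]_k) x v); apply: near_eq_derive.
    have : \near x, N x by exact: open_nbhs_nbhs.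
    by apply: filterS => y /ZP.
  have : mu x a b *m (Ym x *m P) = 0.
    have R0 v d : row d ('D_v Z x) *m P = 0 by rewrite -row_mul DZP row0.
    rewrite mulmxA -(muE x a b Nx) mulmxBl.
    by rewrite [X in X - _]R0 [X in _ - X]R0 subrr.
  by move=> E; rewrite -[mu x a b](mulmxK (Gu x Nx)) E mul0mx.
move=> x a b Nx; split.
  by apply/subr0_eq; rewrite muE // mu0 // mul0mx.
have := @curvature_change n k p p g (Y^~ x) A
  (fun i j => commutator (A i x) (A j x)) c x a b (dg x Nx) (fun l => dA l x Nx).
move=> /(_ (fun i j => fl x i j Nx)).
rewrite -!rowZ => H.
have -> : A' a x *m A' b x - A' b x *m A' a x = \sum_(i < k) \sum_(j < k)
    (g x a i * g x b j) *: commutator (A i x) (A j x).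
  rewrite /A' mulmx_suml [X in _ - X]mulmx_suml [X in _ - X](eq_bigr _ (fun j _ => mulmx_sumr _ _ _ _)).
  rewrite [X in _ - X]exchange_big /= -sumrB; apply: eq_bigr => i _.
  rewrite mulmx_sumr -sumrB; apply: eq_bigr => j _.
  by rewrite -!scalemxAl -!scalemxAr !scalerA /commutator scalerBr [X in _ - X *: _]mulrC.
rewrite H big1 // => l _.
by have := congr1 (fun m : 'rV[R]_k => m 0 l) (mu0 x a b Nx); rewrite /mu !mxE => ->; rewrite scale0r.
Qed.

Lemma integrate_system n k p (Y : 'I_k -> 'rV[R]_n -> 'rV[R]_n)
    (A : 'I_k -> 'rV[R]_n -> 'M[R]_p) (c : 'I_k -> 'I_k -> 'I_k -> R)
    (M : set 'rV[R]_n) (x0 : 'rV[R]_n) :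
  open M -> M x0 -> (forall i, smooth_on M (Y i)) -> (forall i, smooth_on M (A i)) ->
  free [tuple Y i x0 | i < k] ->
  (forall x i j, M x ->
    vf_bracket (Y i) (Y j) x = \sum_(l < k) c i j l *: Y l x) ->
  (forall x i j, M x ->
    vf_act (Y i) (A j) x - vf_act (Y j) (A i) x + commutator (A i x) (A j x)
    = \sum_(l < k) c i j l *: A l x) ->
  exists (U : set 'rV[R]_n) (F : 'rV[R]_n -> 'M[R]_p),
    [/\ open U, U x0, U `<=` M & smooth_on U F] /\
    [/\ F x0 = 1%:M,
        forall x i, U x -> vf_act (Y i) F x = F x *m A i x &
        (forall i x, M x -> Defs.skew (A i x)) ->
          forall x, U x -> F x *m (F x)^T = 1%:M].
Proof.
move=> oM Mx0 sY sA fr br fl.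
have [P [N [oN Nx0 NM Gu]]] := frame_exists oM Mx0 sY fr.
have sY' i : smooth_on N (Y i) by move=> l; exact: Ck_on_sub NM (sY i l).
have sA1 i : smooth_on N (A i) by move=> l; exact: Ck_on_sub NM (sA i l).
have [sg sZ] := smooth_frame oN sY' Gu.
pose G x := (\matrix_(i < k) Y i x) *m P.
pose g := frame_gauge Y P; pose Z := frame Y P.
pose A' a x := \sum_(i < k) g x a i *: A i x.
have sA' a : smooth_on N (A' a).
  move=> l; apply: Ck_on_sum => // i _; apply: Ck_on_scale => //; last exact: sA1.
  by have /(Ck_on_mxP _ _ oN) := sg l; exact.
have ZP x : N x -> Z x *m P = 1%:M.
  by move=> Nx; rewrite /Z -mulmxA mulVmx // Gu.
have flat := frame_flat oN sY' sA1 Gu (fun x i j Nx => br x i j (NM x Nx))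
  (fun x i j Nx => fl x i j (NM x Nx)).
have commZ x a b Nx := (flat x a b Nx).1.
have flatA x a b Nx := (flat x a b Nx).2.
have [U [F [[oU Ux0 UN sF] [F0 DF oF]]]] := integrate_frame oN Nx0 sZ sA' ZP commZ flatA.
exists U, F; split; split => //.
- by move=> x /UN /NM.
- move=> x i Ux; have Nx := UN x Ux.
  have dF : differentiable F x by have [d _] := sF 1%N; exact: d.
  (* Back from the frame: [G] is the inverse of [g], so [Y = G Z], and [G g = 1] collapses the
     combination of the [A' a] with coefficients [G x i a] to [A i]. *)
  have YE : Y i x = \sum_(a < k) G x i a *: row a (Z x).
    rewrite -[Y i x](rowK (fun i => Y i x)).
    have -> : \matrix_(j < k) Y j x = G x *m Z x by rewrite /Z mulmxA mulmxV ?mul1mx // Gu.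
    by rewrite row_mul mulmx_sum_row; apply: eq_bigr => a _; rewrite [row i _ 0 a]mxE.
  rewrite /vf_act YE derive_dir_sum //.
  under eq_bigr do rewrite DF // scalemxAr.
  rewrite -mulmx_sumr; congr (_ *m _).
  under eq_bigr do rewrite /A' scaler_sumr.
  rewrite exchange_big /= (bigD1 i) //= [X in _ + X]big1 => [|l li].
    under eq_bigr do rewrite scalerA.
    rewrite -scaler_suml addr0.
    have := congr1 (fun m : 'M[R]_k => m i i) (mulmxV (Gu x Nx)).
    by rewrite !mxE eqxx => ->; rewrite scale1r.
  under eq_bigr do rewrite scalerA.
  rewrite -scaler_suml.
  have := congr1 (fun m : 'M[R]_k => m i l) (mulmxV (Gu x Nx)).
  by rewrite !mxE eq_sym (negbTE li) => ->; rewrite scale0r.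
- move=> skA; apply: oF => a x Nx; rewrite /Defs.skew /= /A' linear_sum -sumrN.
  by apply: eq_bigr => i _; rewrite linearZ /= (skA i x (NM x Nx)) scalerN.
Qed.

End System.

(** * Stochastic transformations *)

Section Main.
Context {R : realType}.

(** Each [V i] lies in the span with Kronecker coefficients; the constants do not depend on the
    point because the span is over the reals. *)
Lemma span_closed_constants n m k (M : set 'rV[R]_n) (V : 'I_k -> inf_stoch R n m) :
  bracket_closed (ist_span M V) ->
  exists c : 'I_k -> 'I_k -> 'I_k -> R,
    forall i j, ist_eq_on M (ist_bracket (V i) (V j)) (ist_lincomb (c i j) V).
Proof.
move=> hK.
have inspan i : ist_span M V (V i).
  exists (fun l => (l == i)%:R) => x _.
  have S (W : lmodType R) (f : 'I_k -> W) : f i = \sum_(l < k) (l == i)%:R *: f l.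
    rewrite (bigD1 i) //= eqxx scale1r big1 ?addr0 // => l /negbTE ->.
    by rewrite scale0r.
  split; rewrite /=; [exact: S|exact: S|exact: (S R^o (fun l => isttau (V l) x))|exact: S].
have H i : exists c : 'I_k -> 'I_k -> R,
    forall j, ist_eq_on M (ist_bracket (V i) (V j)) (ist_lincomb (c j) V).
  by have [c Hc] := choice (fun j => hK _ _ (inspan i) (inspan j)); exists c.
by have [c Hc] := choice H; exists c.
Qed.

Lemma vf_pushforward_id n (Y : 'rV[R]_n -> 'rV[R]_n) : vf_pushforward id id Y = Y.
Proof.
apply/funext => x; rewrite /vf_pushforward /=.
by rewrite -deriveEjacobian ?derive_id //; exact: ex_diff.
Qed.

Lemma near_positive (V : normedModType R) (f : V -> R) x : {for x, continuous f} ->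
  0 < f x -> \forall y \near x, 0 < f y.
Proof. by move=> cf f0; exact: (cvgr_gt (f x) cf 0 f0). Qed.

(** Write [r = (l, s)] with [s] its last entry. The zero right column of the block matrix makes the
    derivative of [s] vanish, so dividing by [s] commutes with the derivative. Transposing [l] turns
    [- C] into [C] by skewness. *)
Lemma affine_solution n m (Y : 'rV[R]_n) (r : 'rV[R]_n -> 'rV[R]_(m + 1))
    (t : R) (C : 'M[R]_m) (H : 'cV[R]_m) x :
  differentiable r x -> C^T = - C -> rsubmx (r x) 0 0 != 0 ->
  'D_Y r x = r x *m block_mx ((- (t / 2))%:M - C) 0 (- H^T) 0 ->
  'D_Y (fun y => (rsubmx (r y) 0 0)^-1 *: (lsubmx (r y))^T) x =
    ((- (t / 2))%:M + C) *m ((rsubmx (r x) 0 0)^-1 *: (lsubmx (r x))^T) - H.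
Proof.
move=> dr skC l0 Dr.
have Hr := derivableP (@diff_derivable _ _ _ _ _ Y dr); rewrite Dr in Hr.
rewrite -{1}[r x]hsubmxK mul_row_block !mulmx0 addr0 in Hr.
have Hl := is_derive_lmx trmx (is_derive_lmx lsubmx Hr).
have Hm := (is_derive_mxP _ _ _ _).1 (is_derive_lmx rsubmx Hr) 0 0.
rewrite /= row_mxKl in Hl; rewrite /= row_mxKr mxE in Hm.
have Hi : is_derive x Y (fun y => (rsubmx (r y) 0 0)^-1) 0.
  apply: DeriveDef; first by apply: derivableV => //; case: Hm.
  rewrite deriveV //.
  by rewrite (@derive_val _ _ _ _ _ _ _ Hm) scaler0.
have Hs := is_derive_scale Hi Hl.
rewrite (@derive_val _ _ _ _ _ _ _ Hs) scale0r add0r.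
rewrite linearD /= !trmx_mul linearB /= tr_scalar_mx skC opprK linearN /= trmxK.
rewrite mulNmx -scalemxAr scalerBr; congr (_ - _).
have -> : (rsubmx (r x))^T = (rsubmx (r x) 0 0)%:M.
  by rewrite {1}[rsubmx (r x)]mx11_scalar tr_scalar_mx.
by rewrite mul_mx_scalar scalerA mulVf // scale1r.
Qed.

Lemma is_derive_col_mx (V : normedModType R) m1 m2 n
    (f : V -> 'M[R]_(m1, n)) (g : V -> 'M[R]_(m2, n)) (x v : V) df dg :
  is_derive x v f df -> is_derive x v g dg ->
  is_derive x v (fun y => col_mx (f y) (g y)) (col_mx df dg).
Proof.
move=> /is_derive_mxP Hf /is_derive_mxP Hg; apply/is_derive_mxP => i j.
by under eq_fun do rewrite mxE; rewrite mxE; case: (fintype.split i).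
Qed.

Lemma Ck_on_col_mx (V : normedModType R) m1 m2 n k (U : set V)
    (f : V -> 'M[R]_(m1, n)) (g : V -> 'M[R]_(m2, n)) : open U ->
  Ck_on k U f -> Ck_on k U g -> Ck_on k U (fun x => col_mx (f x) (g x)).
Proof.
move=> oU /(Ck_on_mxP _ _ oU) Hf /(Ck_on_mxP _ _ oU) Hg.
apply/(Ck_on_mxP _ _ oU) => i j; under eq_fun do rewrite mxE.
by case: (fintype.split i).
Qed.

Lemma is_derive_scalar_mx (V : normedModType R) n (f : V -> R) (x v : V) d :
  is_derive x v f d -> is_derive x v (fun y => (f y)%:M : 'M[R]_n) d%:M.
Proof.
move=> H; have := is_derive_scale H (is_derive_cst (1%:M : 'M[R]_n) x v).
rewrite scaler0 addr0 scalemx1.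
by under eq_fun do rewrite scalemx1.
Qed.

Lemma Ck_on_scalar_mx (V : normedModType R) n k (U : set V) (f : V -> R) :
  open U -> Ck_on k U f -> Ck_on k U (fun x => (f x)%:M : 'M[R]_n).
Proof.
move=> oU Hf; under eq_fun do rewrite -scalemx1.
by apply: Ck_on_scale => //; exact: Ck_on_cst.
Qed.

Lemma commutator_scalar_sub m (s t : R) (A B : 'M[R]_m) :
  commutator (s%:M - A) (t%:M - B) = commutator A B.
Proof.
rewrite /commutator !mulmxBl !mulmxBr !mul_scalar_mx !mul_mx_scalar.
rewrite !scale_scalar_mx [t * s]mulrC.
by apply/matrixP => i j; rewrite !mxE; ring.
Qed.

(** With the identity as diffeomorphism, substituting the equations for the derivatives makes the
    last three components cancel; being zero on [U] only, they are smooth by comparison with a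
    constant. *)
Lemma st_pushforward_strong n m (M U : set 'rV[R]_n) (V : inf_stoch R n m)
    (B : 'rV[R]_n -> 'M[R]_m) (eta : 'rV[R]_n -> R) (h : 'rV[R]_n -> 'cV[R]_m) :
  open U -> U `<=` M -> is_inf_stoch M V ->
  (forall x, U x -> 0 < eta x) ->
  (forall x, U x -> [/\ vf_act (istY V) B x = - (B x *m istC V x),
     vf_act (istY V) eta x = - (isttau V x * eta x) &
     vf_act (istY V) h x =
       ((- (isttau V x / 2))%:M + istC V x) *m h x - istH V x]) ->
  is_strong_inf_stoch U (st_pushforward (id_transf U B eta h) V).
Proof.
case: V => Y C tau H oU UM [/= sY _ _ _] eta0 E.
have Z x : U x ->
    let V := st_pushforward (id_transf U B eta h) (InfStoch Y C tau H) in
    [/\ istC V x = 0, isttau V x = 0 & istH V x = 0].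
  move=> Ux; have [EB Ee Eh] := E x Ux; split; rewrite /= ?EB ?Ee ?Eh.
  - by rewrite mulNmx subrr.
  - by rewrite mulNr mulfK ?subrr // gt_eqF // eta0.
  - by rewrite mulmxBr mulmxA scalerBr addrA [X in X - _]addrAC addNr add0r subrr.
have zs (W : normedModType R) (f : 'rV[R]_n -> W) :
    (forall x, U x -> f x = 0) -> smooth_on U f.
  move=> f0 l; apply: Ck_on_congr oU _ (@Ck_on_cst _ _ _ l U 0) => x Ux.
  by rewrite f0.
split=> //; split.
- by move=> l; rewrite /= vf_pushforward_id; exact: Ck_on_sub UM (sY l).
- split; first by apply: zs => x /Z[].
  by move=> x /Z[+ _ _]; rewrite /Defs.skew /= => ->; rewrite trmx0 oppr0.
- by apply: zs => x /Z[].
- by apply: zs => x /Z[].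
Qed.

End Main.

Unset Implicit Arguments.

Theorem theorem38 (R : realType) (n m k : nat) (M : set 'rV[R]_n)
    (V : 'I_k -> inf_stoch R n m) (x0 : 'rV[R]_n)
    (openM : open M)
    (hV : forall i : 'I_k, is_inf_stoch M (V i))
    (hK : bracket_closed (ist_span M V))
    (hx0 : M x0)
    (hfree : free [tuple istY (V i) x0 | i < k]) :
  exists (U : set 'rV[R]_n) (B : 'rV[R]_n -> 'M[R]_m) (eta : 'rV[R]_n -> R)
         (h : 'rV[R]_n -> 'cV[R]_m),
    [/\ [/\ open U, U x0 & U `<=` M],
        is_stoch_transf (id_transf U B eta h),
        (forall i : 'I_k,
           is_strong_inf_stoch U (st_pushforward (id_transf U B eta h) (V i))) &
        forall (i : 'I_k) (x : 'rV[R]_n), U x ->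
          [/\ vf_act (istY (V i)) B x = - (B x *m istC (V i) x),
              vf_act (istY (V i)) eta x = - (isttau (V i) x * eta x) &
              vf_act (istY (V i)) h x =
                ((- (isttau (V i) x / 2))%:M + istC (V i) x) *m h x
                - istH (V i) x]].
Proof.
have [c Hc] := span_closed_constants hK.
pose Y i := istY (V i); pose C i := istC (V i).
pose tau i := isttau (V i); pose H i := istH (V i).
have sY i : smooth_on M (Y i) by have [] := hV i.
have sC i : smooth_on M (C i) by have [_ []] := hV i.
have skC i x : M x -> (C i x)^T = - C i x by have [_ [_ +] _ _] := hV i; apply.
have stau i : smooth_on M (tau i) by have [] := hV i.
have sH i : smooth_on M (H i) by have [] := hV i.
have dC i x : M x -> differentiable (C i) x by have [d _] := sC i 1%N; exact: d.
have dtau i x : M x -> differentiable (tau i) x by have [d _] := stau i 1%N; exact: d.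
have dH i x : M x -> differentiable (H i) x by have [d _] := sH i 1%N; exact: d.
have brY x i j : M x -> vf_bracket (Y i) (Y j) x = \sum_(l < k) c i j l *: Y l x.
  by move=> Mx; have [] := Hc i j x Mx.
have brC x i j : M x -> 'D_(Y i x) (C j) x - 'D_(Y j x) (C i) x
    - commutator (C i x) (C j x) = \sum_(l < k) c i j l *: C l x.
  by move=> Mx; have [] := Hc i j x Mx.
have brtau x i j : M x -> 'D_(Y i x) (tau j) x - 'D_(Y j x) (tau i) x
    = \sum_(l < k) c i j l * tau l x.
  by move=> Mx; have [] := Hc i j x Mx.
have brH x i j : M x -> 'D_(Y i x) (H j) x - 'D_(Y j x) (H i) x
    - ((- (tau i x / 2))%:M + C i x) *m H j x
    + ((- (tau j x / 2))%:M + C j x) *m H i x = \sum_(l < k) c i j l *: H l x.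
  by move=> Mx; have [] := Hc i j x Mx.
(* The transpose of the coefficient [- tau / 2 + C] of [h], as [C] is skew: the unknown will be a
   row vector. *)
pose al i x : 'M[R]_m := (- (tau i x / 2))%:M - C i x.
have sal i l : Ck_on l M (al i).
  apply: Ck_on_add => //; last exact: Ck_on_opp (sC i l).
  apply: Ck_on_scalar_mx => //.
  have := Ck_on_mul openM (@Ck_on_cst R _ _ l M (- 2^-1 : R)) (stau i l).
  by apply: Ck_on_congr => // x _; rewrite /= mulrC mulrN.
have Dal i x v : M x -> is_derive x v (al i) ((- ('D_v (tau i) x / 2))%:M - 'D_v (C i) x).
  move=> Mx.
  have H1 := derivableP (@diff_derivable _ _ _ _ _ v (dtau i x Mx)).
  have H2 := derivableP (@diff_derivable _ _ _ _ _ v (dC i x Mx)).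
  apply: is_deriveB => //; apply: is_derive_scalar_mx.
  have H3 := is_deriveM H1 (is_derive_cst (- 2^-1 : R) x v).
  have -> : (fun y => - (tau i y / 2)) = tau i * cst (- 2^-1).
    by apply/funext => y /=; rewrite -mulrN.
  by apply: (is_derive_eq H3); rewrite scaler0 add0r /GRing.scale /= mulNr mulrC.
have bral x i j : M x -> 'D_(Y i x) (al j) x - 'D_(Y j x) (al i) x
    + commutator (al i x) (al j x) = \sum_(l < k) c i j l *: al l x.
  move=> Mx.
  rewrite (@derive_val _ _ _ _ _ _ _ (Dal j x (Y i x) Mx)).
  rewrite (@derive_val _ _ _ _ _ _ _ (Dal i x (Y j x) Mx)).
  rewrite /al commutator_scalar_sub.
  have -> : \sum_(l < k) c i j l *: ((- (tau l x / 2))%:M - C l x) =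
      (- ((\sum_(l < k) c i j l * tau l x) / 2))%:M - \sum_(l < k) c i j l *: C l x.
    rewrite mulr_suml -sumrN raddf_sum -sumrB; apply: eq_bigr => l _.
    by rewrite scalerBr scale_scalar_mx mulrN mulrA.
  rewrite -brC // -brtau //.
  by apply/matrixP => a b; rewrite !mxE; case: (a == b); rewrite ?mulr1n ?mulr0n; ring.
(* Passing to [- C] turns the minus sign of the commutator in the bracket into the plus sign of a
   curvature. *)
have sC' i : smooth_on M (fun x => - C i x) by move=> l; exact: Ck_on_opp (sC i l).
have brC' x i j : M x -> vf_act (Y i) (fun x => - C j x) x
    - vf_act (Y j) (fun x => - C i x) x + commutator (- C i x) (- C j x)
    = \sum_(l < k) c i j l *: - C l x.
  move=> Mx; rewrite /vf_act.
  have DN v l : 'D_v (fun x => - C l x) x = - 'D_v (C l) x.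
    by rewrite -deriveN //; exact/diff_derivable/dC.
  rewrite !DN; under eq_bigr do rewrite scalerN.
  rewrite sumrN -brC // /commutator !mulmxN !mulNmx !opprK.
  by apply/matrixP => a b; rewrite !mxE; ring.
have [U1 [B [[oU1 U1x U1M sB] [B0 DB oB]]]] :=
  integrate_system openM hx0 sY sC' hfree brY brC'.
(* The scalar equation for [eta] as a system of 1 by 1 matrices, whose commutators vanish. *)
pose A2 i x : 'M[R]_1 := (- tau i x)%:M.
have sA2 i : smooth_on M (A2 i).
  move=> l; apply: Ck_on_scalar_mx => //.
  have := Ck_on_mul openM (@Ck_on_cst R _ _ l M (- 1 : R)) (stau i l).
  by apply: Ck_on_congr => // x _; rewrite /= mulN1r.
have brA2 x i j : M x -> vf_act (Y i) (A2 j) x - vf_act (Y j) (A2 i) x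
    + commutator (A2 i x) (A2 j x) = \sum_(l < k) c i j l *: A2 l x.
  move=> Mx; rewrite /vf_act.
  have D2 v l : 'D_v (A2 l) x = (- 'D_v (tau l) x)%:M.
    have H1 := derivableP (@diff_derivable _ _ _ _ _ v (dtau l x Mx)).
    exact: (@derive_val _ _ _ _ _ _ _ (is_derive_scalar_mx 1 (is_deriveN H1))).
  have -> : commutator (A2 i x) (A2 j x) = 0.
    by rewrite /commutator /A2 scalar_mxC subrr.
  rewrite !D2 addr0; apply/matrixP => a b; rewrite !ord1 summxE.
  under eq_bigr do rewrite !mxE eqxx mulr1n mulrN.
  by rewrite sumrN -brtau // !mxE eqxx !mulr1n; ring.
have [U2 [F2 [[oU2 U2x U2M sF2] [F20 DF2 _]]]] :=
  integrate_system openM hx0 sY sA2 hfree brY brA2.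
(* The affine equation for h becomes linear for the row vector [(h^T, 1)]. *)
pose A3 i x : 'M[R]_(m + 1) := block_mx (al i x) 0 (- (H i x)^T) 0.
have sA3 i : smooth_on M (A3 i).
  move=> l; apply: (@Ck_on_col_mx _ _ _ _ _ _ _ (fun x => row_mx (al i x) 0)
    (fun x => row_mx (- (H i x)^T) 0)) => //; apply: Ck_on_row_mx => //;
    try exact: Ck_on_cst.
  by apply: Ck_on_opp => //; apply: Ck_on_tr => //; exact: sH.
have brA3 x i j : M x -> vf_act (Y i) (A3 j) x - vf_act (Y j) (A3 i) x
    + commutator (A3 i x) (A3 j x) = \sum_(l < k) c i j l *: A3 l x.
  move=> Mx; rewrite /vf_act.
  have D3 v l : 'D_v (A3 l) x = block_mx ('D_v (al l) x) 0 (- ('D_v (H l) x)^T) 0.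
    have H1 := derivableP (@diff_derivable _ _ _ _ _ v (dH l x Mx)).
    have H2 := Dal l x v Mx.
    rewrite (@derive_val _ _ _ _ _ _ _ H2).
    have H0 m' : is_derive x v (cst (0 : 'M[R]_(m', 1))) 0 by exact: is_derive_cst.
    have H4 := is_derive_col_mx (is_derive_row_mx H2 (H0 m))
      (is_derive_row_mx (is_deriveN (is_derive_lmx trmx H1)) (H0 1%N)).
    exact: (@derive_val _ _ _ _ _ _ _ H4).
  rewrite !D3 /commutator /A3 !mulmx_block !mulmx0 !mul0mx !addr0.
  rewrite !(opp_block_mx, add_block_mx) !oppr0 !addr0.
  have -> : \sum_(l < k) c i j l *: block_mx (al l x) 0 (- (H l x)^T) 0 =
      block_mx (\sum_(l < k) c i j l *: al l x) 0
        (- (\sum_(l < k) c i j l *: H l x)^T) 0 :> 'M[R]_(m + 1).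
    elim: (index_enum _) => [|l r IH].
      by rewrite !big_nil trmx0 oppr0 block_mx0.
    rewrite !big_cons IH scale_block_mx add_block_mx !scaler0 !addr0.
    by rewrite [(c i j l *: H l x + _)^T]linearD /= [(c i j l *: H l x)^T]linearZ /= opprD scalerN.
  (* The remaining block is, up to sign, the transpose of the [H] component of the bracket
     relation. *)
  congr block_mx; first exact: bral.
  rewrite -brH // !linearD /= !linearN /= !trmx_mul !linearD /= !tr_scalar_mx !skC //.
  rewrite !mulNmx !mulmxN !opprK.
  by apply/matrixP => a b; rewrite !mxE; ring.
have [U3 [F3 [[oU3 U3x U3M sF3] [F30 DF3 _]]]] :=
  integrate_system openM hx0 sY sA3 hfree brY brA3.
pose eta x := F2 x 0 0.
(* The last entry of [r] is annihilated by all [Y_i] and is 1 at [x0]. *)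
pose r x : 'rV[R]_(m + 1) := row (rshift m 0) (F3 x).
pose lam x := rsubmx (r x) 0 0.
pose h x := (lam x)^-1 *: (lsubmx (r x))^T.
have seta : smooth_on U2 eta by move=> l; have /(Ck_on_mxP _ _ oU2) := sF2 l; exact.
have sr : smooth_on U3 r by move=> l; apply: (@Ck_on_linear_mx _ _ _ _ _ _ _ (row (rshift m 0))).
have slam : smooth_on U3 lam.
  by move=> l; have /(Ck_on_mxP _ _ oU3) := Ck_on_rsubmx oU3 (sr l); exact.
have [U [[oU Ux] UU]] : exists U, open_nbhs x0 U /\
    U `<=` [set x | [/\ U1 x, U2 x & U3 x] /\
                    [/\ 0 < \det (B x), 0 < eta x & 0 < lam x]].
  have near1 (W : set 'rV[R]_n) (f : 'rV[R]_n -> R) : open W -> W x0 ->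
      Ck_on 0 W f -> 0 < f x0 -> \forall x \near x0, W x /\ 0 < f x.
    move=> oW Wx Hf f0; have H1 : \near x0, W x0 by exact: open_nbhs_nbhs.
    have H2 : \forall x \near x0, 0 < f x.
      by apply: near_positive => //; apply: Hf; rewrite inE.
    by apply: filterS2 H1 H2.
  have N1 : \forall x \near x0, U1 x /\ 0 < \det (B x).
    by apply: near1 oU1 U1x (Ck_on_det oU1 (sB 0%N)) _; rewrite B0 det1 ltr01.
  have N2 : \forall x \near x0, U2 x /\ 0 < eta x.
    by apply: near1 oU2 U2x (seta 0%N) _; rewrite /eta F20 mxE eqxx ltr01.
  have N3 : \forall x \near x0, U3 x /\ 0 < lam x.
    by apply: near1 oU3 U3x (slam 0%N) _; rewrite /lam /r F30 !mxE eqxx ltr01.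
  have : nbhs x0 [set x | [/\ U1 x, U2 x & U3 x] /\
                    [/\ 0 < \det (B x), 0 < eta x & 0 < lam x]].
    by apply: filterS3 N1 N2 N3 => x [? ?] [? ?] [? ?].
  by rewrite nbhsE => -[W oW sW]; exists W.
have UU1 : U `<=` U1 by move=> x /UU[[]].
have UU2 : U `<=` U2 by move=> x /UU[[]].
have UU3 : U `<=` U3 by move=> x /UU[[]].
have UM : U `<=` M by move=> x /UU1/U1M.
have E i x : U x -> [/\ vf_act (Y i) B x = - (B x *m C i x),
    vf_act (Y i) eta x = - (tau i x * eta x) &
    vf_act (Y i) h x = ((- (tau i x / 2))%:M + C i x) *m h x - H i x].
  move=> Ux'; have Mx := UM x Ux'; have [[V1 V2 V3] [_ _ l0]] := UU x Ux'; split.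
  - by rewrite DB // mulmxN.
  - have d2 : differentiable F2 x by have [d _] := sF2 1%N; exact: d.
    have H1 := derivableP (@diff_derivable _ _ _ _ _ (Y i x) d2).
    rewrite /vf_act (@derive_val _ _ _ _ _ _ _ ((is_derive_mxP _ _ _ _).1 H1 0 0)).
    have -> : 'D_(Y i x) F2 x = F2 x *m A2 i x by exact: DF2.
    by rewrite /A2 mul_mx_scalar mxE mulNr.
  - have dr : differentiable r x by have [d _] := sr 1%N; exact: d.
    apply: affine_solution => //; [exact: skC|by rewrite gt_eqF|].
    have d3 : differentiable F3 x by have [d _] := sF3 1%N; exact: d.
    have H1 := derivableP (@diff_derivable _ _ _ _ _ (Y i x) d3).
    rewrite (@derive_val _ _ _ _ _ _ _ (is_derive_lmx (row (rshift m 0)) H1)).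
    have -> : 'D_(Y i x) F3 x = F3 x *m A3 i x by exact: DF3.
    by rewrite /= row_mul.
exists U, B, eta, h; split => //.
- split => //=.
  + have sid l : Ck_on l U (id : 'rV[R]_n -> 'rV[R]_n) by exact: Ck_on_id.
    by split => //; split => // x.
  + split; first by move=> l; exact: Ck_on_sub UU1 (sB l).
    move=> x Ux'; have [[V1 _ _] [dB _ _]] := UU x Ux'.
    have BB : B x *m (B x)^T = 1%:M.
      by apply: oB => // i y My; rewrite /Defs.skew /= linearN /= skC.
    split => //; have := congr1 determinant BB.
    (* Orthogonality leaves the determinants 1 and -1, and positivity on [U] excludes the latter. *)
    rewrite det_mulmx det_tr det1 -expr2 => /eqP; rewrite sqrf_eq1.
    by case/orP => /eqP // dN; move: dB; rewrite dN oppr_gt0 ltr10.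
  + by split; [move=> l; exact: Ck_on_sub UU2 (seta l)|move=> x /UU[_ []]].
  + move=> l; apply: Ck_on_scale => //.
      apply: Ck_on_inv => //; last exact: Ck_on_sub UU3 (slam l).
      by move=> x /UU[_ [_ _ l0]]; rewrite gt_eqF.
    apply: Ck_on_tr => //; apply: Ck_on_lsubmx => //.
    exact: Ck_on_sub UU3 (sr l).
- move=> i; apply: (st_pushforward_strong oU UM (hV i)) => x Ux'; last exact: E.
  by have [_ []] := UU x Ux'.
Qed.
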